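(* Let $\{q_k:k\ge 0\}$ be a sequence of non-negative numbers with $q_0>0$, let $Q_n:=\sum_{k=0}^{n-1}q_k$, and let $T_nf:=\frac{1}{Q_n}\sum_{k=0}^{n-1}q_kS_kf$ ($n\in\mathbb{N}_+$) be the corresponding $T$ means with respect to a bounded Vilenkin system. (a) Suppose that either (i) $\{q_k\}$ is nondecreasing and there is a constant $c>0$ such that $\frac{q_0}{Q_{M_{2n}+2}}\ge \frac{c}{M_{2n}}$ for all $n\in\mathbb{N}$; or (ii) $\{q_k\}$ is nonincreasing and there is a constant $c>0$ such that $\frac{q_{M_{2n}+1}}{Q_{M_{2n}+2}}\ge \frac{c}{M_{2n}}$ for all $n\in\mathbb{N}$. Then for any increasing function $\varphi:\mathbb{N}_+\to[1,\infty)$ satisfying $\lim_{n\to\infty}\varphi(n)=\infty$ and $$\limsup_{n\to\infty}\frac{\log^2(n+1)}{\varphi(n+1)}=+\infty,$$ there exists a martingale $f\in H_{1/2}$ such that $$\left\|\sup_{n\in\mathbb{N}_+}\frac{|T_nf|}{\varphi(n)}\right\|_{1/2}=\infty.$$ (b) Let $0<p<1/2$, and suppose that either $\{q_k\}$ is nondecreasing, or $\{q_k\}$ is nonincreasing and there is a constant $c>0$ such that $\frac{q_{M_{2n}+1}}{Q_{M_{2n}+2}}\ge \frac{c}{M_{2n}}$ for all $n\in\mathbb{N}$. Then for any increasing function $\varphi:\mathbb{N}_+\to[1,\infty)$ satisfying $$\limsup_{n\to\infty}\frac{(n+1)^{1/p-2}}{\varphi(n+1)}=+\infty,$$ there exists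 a martingale $f\in H_p$ such that $$\left\|\sup_{n\in\mathbb{N}_+}\frac{|T_nf|}{\varphi(n)}\right\|_{\mathrm{weak}\text{-}L_p}=\infty.$$
   Context: $\mathbb{N}_+$ denotes the positive integers and $\mathbb{N}:=\mathbb{N}_+\cup\{0\}$. Let $m=(m_0,m_1,\dots)$ be a bounded sequence of integers $m_k\ge 2$ ($\sup_k m_k<\infty$; this boundedness is assumed throughout). Let $Z_{m_k}=\{0,1,\dots,m_k-1\}$ be the additive group of integers modulo $m_k$, and let $G_m=\prod_{k\ge0}Z_{m_k}$ be the complete direct product with the product topology of the discrete topologies; elements are $x=(x_0,x_1,\dots)$ with $x_j\in Z_{m_j}$. Let $\mu$ be the product of the measures $\mu_k(\{j\})=1/m_k$, i.e. the Haar measure with $\mu(G_m)=1$. Put $I_0(x):=G_m$ and $I_n(x):=\{y\in G_m: y_0=x_0,\dots,y_{n-1}=x_{n-1}\}$. Put $M_0:=1$, $M_{k+1}:=m_kM_k$. Every $n\in\mathbb{N}$ is uniquely $n=\sum_{j\ge0}n_jM_j$ with $n_j\in Z_{m_j}$, only finitely many $n_j$ nonzero. The generalized Rademacher functions are $r_k(x):=\exp(2\pi i x_k/m_k)$ and the Vilenkin system is $\psi_n(x):=\prod_{k\ge0}r_k^{n_k}(x)$, $n\in\mathbb{N}$. For $0<p<\infty$: $\|f\|_p^p:=\int_{G_m}|f|^p\,d\mu$ and $\|f\|_{\mathrm{weak}\text{-}L_p}^p:=\sup_{\lambda>0}\lambda^p\mu(|f|>\lambda)$. Let $\digamma_n$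 be the $\sigma$-algebra generated by $\{I_n(x):x\in G_m\}$. Martingales $f=(f^{(n)},n\in\mathbb{N})$ are with respect to $(\digamma_n)_{n\in\mathbb{N}}$. The maximal function is $f^*:=\sup_{n\in\mathbb{N}}|f^{(n)}|$, and for $0<p<\infty$ the martingale Hardy space $H_p$ consists of all martingales with $\|f\|_{H_p}:=\|f^*\|_p<\infty$. The Vilenkin–Fourier coefficients of a martingale are $\widehat f(i):=\lim_{k\to\infty}\int_{G_m}f^{(k)}\overline{\psi_i}\,d\mu$, and the partial sums are $S_nf:=\sum_{k=0}^{n-1}\widehat f(k)\psi_k$, with $S_0f=0$. *)

(* Defs.v *)
(* MathComp-Analysis; complex numbers are the type R[i] of real-closed. *)
From HB Require Import structures.
From mathcomp Require Import all_boot all_order all_algebra.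
From mathcomp Require Import complex.
From mathcomp Require Import all_classical all_reals all_analysis.

Set Implicit Arguments.
Unset Strict Implicit.
Unset Printing Implicit Defensive.

Import Order.TTheory GRing.Theory Num.Theory.
Import numFieldNormedType.Exports.

Local Open Scope classical_set_scope.
Local Open Scope ring_scope.
Local Open Scope complex_scope.

(* 'Z_n is the integers mod n only for 1 < n; every result about G_m below
   is to be read under the assumption 1 < m k for all k. *)
Definition vilenkin_point (m : nat -> nat) : Type := forall k, 'Z_(m k).

HB.instance Definition _ (m : nat -> nat) :=
  Choice.copy (vilenkin_point m) (forall k, 'Z_(m k)).
HB.instance Definition _ (m : nat -> nat) :=
  isPointed.Build (vilenkin_point m) (fun=> 0).

Definition cyl (m : nat -> nat) (n : nat) (x : vilenkin_point m) :
    set (vilenkin_point m) :=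
  [set y | forall k, (k < n)%N -> y k = x k].

Definition cylinders (m : nat -> nat) : set (set (vilenkin_point m)) :=
  [set A | exists n x, A = cyl n x].

(* The cylinders are a countable base of the product topology of G_m, so they
   generate its Borel sigma-algebra. *)
Definition vilenkin (m : nat -> nat) := g_sigma_algebraType (@cylinders m).

Definition filtration (m : nat -> nat) (n : nat) :
    set (set (vilenkin_point m)) :=
  <<s range (@cyl m n) >>.

(* The product of the uniform probabilities on the 'Z_(m k): by uniqueness of
   the extension, the product rule on finite-dimensional rectangles determines
   mu. *)
Definition is_haar (R : realType) (m : nat -> nat)
    (mu : probability (vilenkin m) R) : Prop :=
  forall (n : nat) (A : forall k, {set 'Z_(m k)}),
    mu [set x : vilenkin m | forall k, (k < n)%N -> x k \in A k] =
    (\prod_(k < n) (#|A k|%:R / (m k)%:R))%:E.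

Fixpoint genM (m : nat -> nat) (k : nat) : nat :=
  if k is k'.+1 then (m k' * genM m k')%N else 1%N.

(* The coefficient n_j in the expansion n = \sum_j n_j M_j. *)
Definition digit (m : nat -> nat) (n j : nat) : nat :=
  ((n %/ genM m j) %% m j)%N.

Definition rademacher (R : realType) (m : nat -> nat) (k : nat)
    (x : vilenkin_point m) : R[i] :=
  let t : R := 2 * pi * (x k : nat)%:R / (m k)%:R in cos t +i* sin t.

(* Since n < 2 ^ n <= M_n, the digits n_k with n <= k vanish, so the product
   over all k is the product over k < n. *)
Definition psi (R : realType) (m : nat -> nat) (n : nat)
    (x : vilenkin_point m) : R[i] :=
  \prod_(k < n) rademacher R k x ^+ digit m n k.

Definition Cintegrable (R : realType) (m : nat -> nat)
    (mu : probability (vilenkin m) R) (g : vilenkin_point m -> R[i]) : Prop :=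
  mu.-integrable setT (fun x => (complex.Re (g x))%:E) /\
  mu.-integrable setT (fun x => (complex.Im (g x))%:E).

Definition Cintegral (R : realType) (m : nat -> nat)
    (mu : probability (vilenkin m) R) (D : set (vilenkin_point m))
    (g : vilenkin_point m -> R[i]) : R[i] :=
  (\int[mu]_(x in D) complex.Re (g x)) +i* (\int[mu]_(x in D) complex.Im (g x)).

Definition filtration_measurable (R : realType) (m : nat -> nat) (n : nat)
    (g : vilenkin_point m -> R[i]) : Prop :=
  forall B : set R, measurable B ->
    filtration n ((fun x => complex.Re (g x)) @^-1` B) /\
    filtration n ((fun x => complex.Im (g x)) @^-1` B).

(* The third clause is E[f^(k) | F_n] = f^(n). *)
Definition martingale (R : realType) (m : nat -> nat)
    (mu : probability (vilenkin m) R) (f : nat -> vilenkin_point m -> R[i]) :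
    Prop :=
  [/\ forall n, filtration_measurable n (f n),
      forall n, Cintegrable mu (f n)
    & forall n k A, (n <= k)%N -> filtration n A ->
        Cintegral mu A (f k) = Cintegral mu A (f n)].

Definition maximal (R : realType) (m : nat -> nat)
    (f : nat -> vilenkin_point m -> R[i]) (x : vilenkin_point m) : \bar R :=
  ereal_sup [set (Normc.normc (f n x))%:E | n in [set: nat]].

Definition hardy_norm (R : realType) (m : nat -> nat)
    (mu : probability (vilenkin m) R) (p : R)
    (f : nat -> vilenkin_point m -> R[i]) : \bar R :=
  Lnorm mu p%:E (maximal f).

Definition in_hardy (R : realType) (m : nat -> nat)
    (mu : probability (vilenkin m) R) (p : R)
    (f : nat -> vilenkin_point m -> R[i]) : Prop :=
  martingale mu f /\ (hardy_norm mu p f < +oo)%E.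

Definition weak_Lnorm (R : realType) (m : nat -> nat)
    (mu : probability (vilenkin m) R) (p : R)
    (g : vilenkin_point m -> \bar R) : \bar R :=
  (ereal_sup [set (lam `^ p)%:E * mu [set x | lam%:E < `|g x|]
             | lam in [set lam : R | (0 < lam)%R]] `^ p^-1)%E.

(* R[i]^o carries the norm topology of the complex plane. *)
Definition fourier_coef (R : realType) (m : nat -> nat)
    (mu : probability (vilenkin m) R) (f : nat -> vilenkin_point m -> R[i])
    (i : nat) : R[i] :=
  limn (fun k => Cintegral mu setT (fun x => f k x * (psi R i x)^*) : R[i]^o).

Definition partial_sum (R : realType) (m : nat -> nat)
    (mu : probability (vilenkin m) R) (f : nat -> vilenkin_point m -> R[i])
    (n : nat) (x : vilenkin_point m) : R[i] :=
  \sum_(k < n) fourier_coef mu f k * psi R k x.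

Definition Qsum (R : realType) (q : nat -> R) (n : nat) : R :=
  \sum_(k < n) q k.

Definition T_mean (R : realType) (m : nat -> nat)
    (mu : probability (vilenkin m) R) (q : nat -> R)
    (f : nat -> vilenkin_point m -> R[i]) (n : nat) (x : vilenkin_point m) :
    R[i] :=
  (Qsum q n)^-1%:C * \sum_(k < n) (q k)%:C * partial_sum mu f k x.

Definition weighted_maximal_T (R : realType) (m : nat -> nat)
    (mu : probability (vilenkin m) R) (q phi : nat -> R)
    (f : nat -> vilenkin_point m -> R[i]) (x : vilenkin_point m) : \bar R :=
  ereal_sup [set (Normc.normc (T_mean mu q f n x) / phi n)%:E
            | n in [set n : nat | (0 < n)%N]].

(* phi : N_+ -> [1, +oo[ increasing in the wide sense (which includes the
   strictly increasing weights); the value phi 0 is irrelevant. *)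
Definition increasing_weight (R : realType) (phi : nat -> R) : Prop :=
  (forall n, (0 < n)%N -> 1 <= phi n) /\
  (forall n k, (0 < n)%N -> (n <= k)%N -> phi n <= phi k).

(* Main.v *)
Require Import Defs.
From mathcomp Require Import all_boot all_order all_algebra.
From mathcomp Require Import complex.
From mathcomp Require Import all_classical all_reals all_analysis.
From mathcomp Require Import measurable_realfun zify ring lra.

(** The divergence comes from a lacunary martingale.  Let [M_k] be the
    generalized powers and [D_(M_a)] the Dirichlet kernel of order [M_a], which
    is [M_a] times the indicator of the cylinder of level [a] around the origin.
    The block [D_(M_(a+1)) - D_(M_a)] is a sum of consecutive characters, its
    conditional expectation at level [a] is zero and its maximal function is at
    most [M_(a+1)] times the indicator of that cylinder, so the [p]-th power of
    its [H_p] norm is of order [M_a^(p-1)].  The martingale is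
    [f = \sum_k c_k (D_(M_(a_k+1)) - D_(M_(a_k)))] with
    [c_k = (2 ^- k.+1 * M_(a_k)^(1-p))^(1/p)]; by the subadditivity of the
    [p]-th power it belongs to [H_p] for every increasing sequence of levels
    [a_k] ([lacunary_in_hardy]).  Its Fourier coefficients are [c_k] on the
    [k]-th block and zero elsewhere ([fourier_lacunary_on],
    [fourier_lacunary_off]); this rests on the orthogonality relation
    [Cintegral_cyl_psi], obtained from the invariance of the Haar measure under
    the rotation of one coordinate.

    Consider the [T] mean of order [M_(a_k) + L] with [L <= M_(a_k)].  The
    characters [psi_(M_(a_k) + i)] with [i < M_b] agree on the cylinder of level
    [b], so for [L = M_b] the [k]-th block contributes there exactly
    [c_k * (\sum_(u < L) q_(M_(a_k) + u) * u) / Q_(M_(a_k) + L)] in absolute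
    value, while the earlier blocks contribute at most a constant [C] that
    depends only on the earlier levels ([T_mean_lacunary]).  Hence each level
    can be chosen so high, given the previous ones, that the growth hypothesis
    on [phi] makes the [k]-th block dominate both [C] and [k]
    ([choose_levels]).

    For [p < 1/2] the order [M_(a_k) + 2] suffices: the lower bound is
    [c_k / M_(a_k)], that is [M_(a_k)^(1/p - 2)] up to a constant that depends
    only on [k] and the weights, at every point of the group, and the weighted
    maximal function is infinite everywhere ([weak_divergence]).

    For [p = 1/2] these lower bounds are large only near the origin, and all
    scales are needed.  With [a_k = 2 n_k] and [L = M_(2s)] the lower bound on
    the cylinder of level [2s] is proportional to [M_(2s)^2 / phi], whose square
    root has integral of order [1 / sqrt phi] over the difference of the
    cylinders of levels [2s] and [2s+1].  Summation over [1 <= s <= n_k] gives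
    [n_k / sqrt phi], which is comparable with the square root of [log^2 / phi]
    because [n_k] is comparable with the logarithm of the order
    ([sqrt_integral_lower], [strong_divergence]). *)

Import Order.TTheory GRing.Theory Num.Theory.
Import numFieldNormedType.Exports.

Local Open Scope classical_set_scope.
Local Open Scope ring_scope.
Local Open Scope complex_scope.

Set Implicit Arguments.
Unset Strict Implicit.
Unset Printing Implicit Defensive.

(** * Generalized powers, digits and characters *)

Section GeneralizedPowers.
Context (m : nat -> nat) (m_ge2 : forall k, (2 <= m k)%N).
Local Notation M := (genM m).

Lemma genM_gt0 k : (0 < M k)%N.
Proof.
by elim: k => //= k IH; rewrite muln_gt0 IH andbT (leq_trans _ (m_ge2 k)).
Qed.

Lemma genM_dvd a b : (a <= b)%N -> (M a %| M b)%N.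
Proof.
elim: b => [|b IH]; first by rewrite leqn0 => /eqP->.
rewrite leq_eqVlt => /predU1P[->//|]; rewrite ltnS => /IH h.
exact: dvdn_mull.
Qed.

Lemma genM_le a b : (a <= b)%N -> (M a <= M b)%N.
Proof. by move=> ab; apply: dvdn_leq (genM_gt0 b) (genM_dvd ab). Qed.

Lemma genM_double a b : (a < b)%N -> (2 * M a <= M b)%N.
Proof.
move=> /genM_le; apply: leq_trans => /=.
by rewrite leq_mul2r m_ge2 orbT.
Qed.

Lemma genM_lt a b : (a < b)%N -> (M a < M b)%N.
Proof. by move=> /genM_double; have := genM_gt0 a; lia. Qed.

Lemma ltn_genM k : (k < M k)%N.
Proof.
by elim: k => // k IH; apply: leq_ltn_trans IH _; apply: genM_lt.
Qed.

Lemma genM_bracket i : (0 < i)%N -> exists l, (M l <= i < M l.+1)%N.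
Proof.
move=> i0; have ex : exists l, (i < M l)%N by exists i; apply: ltn_genM.
case: (ex_minnP ex) => -[|l] il lmin; first by move: il i0; rewrite /= ltnS; lia.
exists l; rewrite il andbT leqNgt; apply/negP => /lmin; by rewrite ltnn.
Qed.

Lemma genM_bound B a d : (forall k, (m k <= B)%N) ->
  (M (a + d) <= B ^ d * M a)%N.
Proof.
move=> mB; elim: d => [|d IH]; first by rewrite addn0 mul1n.
by rewrite addnS /= expnS -mulnA leq_mul.
Qed.

Lemma digit_small n k : (n < M k)%N -> digit m n k = 0%N.
Proof. by move=> h; rewrite /digit divn_small // mod0n. Qed.

Lemma digit_top n l : (M l <= n < M l.+1)%N -> (0 < digit m n l < m l)%N.
Proof.
move=> /andP[h1 h2]; rewrite /digit modn_small ?divn_gt0 ?genM_gt0 ?h1 //.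
  by rewrite ltn_divLR ?genM_gt0.
by rewrite ltn_divLR ?genM_gt0.
Qed.

(** Adding less than [M b] to [M a] only changes the digits below [b]. *)
Lemma digit_add a b i k : (b <= a)%N -> (b <= k)%N -> (i < M b)%N ->
  digit m (M a + i) k = digit m (M a) k.
Proof.
move=> ba bk ib; have [ka|ak] := leqP k a.
  rewrite /digit divnDl ?genM_dvd // (divn_small (m := i)) ?addn0 //.
  exact: leq_trans ib (genM_le bk).
rewrite !digit_small //; first exact: genM_lt.
apply: leq_trans (genM_double ak).
by rewrite mul2n -addnn ltn_add2l (leq_trans ib) // genM_le.
Qed.

End GeneralizedPowers.

Definition origin (m : nat -> nat) : vilenkin_point m := fun=> 0.

Section VilenkinFunctions.
Context (R : realType) (m : nat -> nat) (m_ge2 : forall k, (2 <= m k)%N).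
Local Notation M := (genM m).
Implicit Types x y : vilenkin_point m.

Definition cis (t : R) : R[i] := cos t +i* sin t.

Lemma cis0 : cis 0 = 1.
Proof. by rewrite /cis cos0 sin0. Qed.

Lemma cisD s t : cis (s + t) = cis s * cis t.
Proof. by rewrite /cis cosD sinD; simpc; congr (_ +i* _); ring. Qed.

Lemma cisMn t n : cis (t *+ n) = cis t ^+ n.
Proof. by elim: n => [|n IH]; rewrite ?cis0 // mulrS exprS cisD IH. Qed.

Lemma normc_cis t : Normc.normc (cis t) = 1.
Proof. by rewrite /cis /Normc.normc cos2Dsin2 sqrtr1. Qed.

Lemma cis2pi : cis (pi *+ 2) = 1.
Proof. by rewrite /cis cos2pi sin2pi. Qed.

Lemma cis_neq1 t : 0 < t -> t < pi *+ 2 -> cis t != 1.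
Proof.
move=> t0 t1; apply/eqP => -[] cost _.
have s0 : 0 < sin (t / 2) by apply: sin_gt0_pi; lra.
have E : cos t = 1 - 2 * sin (t / 2) ^+ 2.
  rewrite {1}(_ : t = (t / 2) *+ 2); last by field.
  have := cos2Dsin2 (t / 2); rewrite cos_mulr2n; lra.
have : 0 < sin (t / 2) ^+ 2 by rewrite exprn_gt0.
lra.
Qed.

Lemma rademacherE k x :
  rademacher R k x = cis (pi *+ 2 / (m k)%:R *+ (x k : nat)).
Proof.
rewrite /rademacher /cis -mulr_natr.
by congr (cos _ +i* sin _); rewrite -mulr_natr; ring.
Qed.

Lemma rademacher0 k x : x k = 0 -> rademacher R k x = 1.
Proof. by move=> x0; rewrite rademacherE x0 cis0. Qed.

Lemma normc_rademacher k x : Normc.normc (rademacher R k x) = 1.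
Proof. exact: normc_cis. Qed.

Lemma normc_prod n (F : nat -> R[i]) :
  Normc.normc (\prod_(k < n) F k) = \prod_(k < n) Normc.normc (F k).
Proof.
elim: n => [|n IH]; first by rewrite !big_ord0 Normc.normc1.
by rewrite !big_ord_recr /= Normc.normcM IH.
Qed.

Lemma normc_exp (z : R[i]) n : Normc.normc (z ^+ n) = Normc.normc z ^+ n.
Proof.
by elim: n => [|n IH]; rewrite ?Normc.normc1 // !exprS Normc.normcM IH.
Qed.

Lemma normc_psi n x : Normc.normc (psi R n x) = 1.
Proof.
rewrite /psi (normc_prod n (fun k => rademacher R k x ^+ digit m n k)).
by apply: big1 => k _; rewrite normc_exp normc_rademacher expr1n.
Qed.

Lemma psi_widen n N x : (n <= N)%N ->
  psi R n x = \prod_(k < N) rademacher R k x ^+ digit m n k.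
Proof.
move=> nN; rewrite /psi -(subnKC nN) big_split_ord /=.
rewrite [X in _ * X]big1 ?mulr1 // => i _.
rewrite digit_small ?expr0 //.
by apply: leq_trans (ltn_genM m_ge2 n) _; rewrite genM_le // leq_addr.
Qed.

Lemma psi_level n x y : cyl n x y -> psi R n x = psi R n y.
Proof.
move=> xy; apply: eq_bigr => k _; congr (_ ^+ _).
by rewrite !rademacherE xy.
Qed.

Lemma psi_cyl0 a n x : (n < M a)%N -> cyl a (origin m) x -> psi R n x = 1.
Proof.
move=> na x0; apply: big1 => k _; have [ka|ak] := ltnP k a.
  by rewrite rademacher0 ?expr1n // x0.
by rewrite digit_small ?expr0 //; apply: leq_trans na (genM_le m_ge2 ak).
Qed.

(** On the cylinder of level [b] around the origin the characters [psi_(M_a)],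
    ..., [psi_(M_a + M_b - 1)] coincide, so their sums do not cancel there. *)
Lemma psi_add a b i x : (b <= a)%N -> (i < M b)%N -> cyl b (origin m) x ->
  psi R (M a + i)%N x = psi R (M a) x.
Proof.
move=> ba ib x0; rewrite [RHS](@psi_widen _ (M a + i)) ?leq_addr //.
apply: eq_bigr => k _; have [kb|bk] := ltnP k b.
  by rewrite rademacher0 ?expr1n // x0.
by rewrite (digit_add m_ge2 ba bk ib).
Qed.

End VilenkinFunctions.

(** * Cylinder sets and the filtration *)

Section CylinderSets.
Context (m : nat -> nat) (m_ge2 : forall k, (2 <= m k)%N).
Implicit Types x y : vilenkin_point m.

Lemma cyl_sym n x y : cyl n x y -> cyl n y x.
Proof. by move=> xy k kn; rewrite xy. Qed.

Lemma cyl_trans n x y z : cyl n x y -> cyl n y z -> cyl n x z.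
Proof. by move=> xy yz k kn; rewrite yz // xy. Qed.

Lemma cyl_weak n n' x y : (n <= n')%N -> cyl n' x y -> cyl n x y.
Proof. by move=> nn xy k kn; apply: xy; apply: leq_trans nn. Qed.

(** These are the functions measurable for the [n]-th sigma-algebra of the
    filtration (see [leveled_preimage]); since cylinders of a given level are
    finite in number, they are also bounded, hence integrable. *)
Definition leveled (T : Type) (n : nat) (g : vilenkin_point m -> T) : Prop :=
  forall x y, cyl n x y -> g x = g y.

Lemma leveledW (T : Type) n n' (g : vilenkin_point m -> T) :
  (n <= n')%N -> leveled n g -> leveled n' g.
Proof. by move=> nn gn x y /(cyl_weak nn); apply: gn. Qed.

Lemma leveled_comp (T U : Type) n (g : vilenkin_point m -> T) (h : T -> U) :
  leveled n g -> leveled n (fun x => h (g x)).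
Proof. by move=> gn x y /gn ->. Qed.

Lemma leveled_comp2 (T U V : Type) n (g : vilenkin_point m -> T)
    (h : vilenkin_point m -> U) (k : T -> U -> V) :
  leveled n g -> leveled n h -> leveled n (fun x => k (g x) (h x)).
Proof. by move=> gn hn x y xy; rewrite (gn _ _ xy) (hn _ _ xy). Qed.

Lemma leveled_indic (R : realType) n x :
  leveled n (\1_(cyl n x) : vilenkin_point m -> R).
Proof.
move=> y z yz; rewrite !indicE; congr ((_ : bool)%:R).
apply/idP/idP; rewrite !inE => h; first exact: cyl_trans h yz.
by apply: cyl_trans h _; apply: cyl_sym.
Qed.

(** Its finite codomain is what makes level-[n] unions of cylinders countable
    and level-[n] functions bounded. *)
Definition prefix_of n x : {dffun forall k : 'I_n, 'Z_(m k)} :=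
  [ffun k : 'I_n => x k].

Lemma prefix_ofP n x y : (prefix_of n x = prefix_of n y) <-> cyl n x y.
Proof.
split=> [/ffunP h k kn|h].
  by have := h (Ordinal kn); rewrite !ffunE.
by apply/ffunP => k; rewrite !ffunE h.
Qed.

(** Such a set is the union of the cylinders of its points, indexed by the
    codes of their prefixes. *)
Lemma leveled_filtration n (A : set (vilenkin_point m)) :
  (forall x y, cyl n x y -> A x -> A y) -> filtration n A.
Proof.
move=> sat.
pose F (i : nat) : set (vilenkin_point m) :=
  [set y | A y /\ pickle (prefix_of n y) = i].
have -> : A = \bigcup_i F i.
  by apply/seteqP; split=> [x Ax|x [i _ []] //]; exists (pickle (prefix_of n x)).
apply: sigma_algebra_bigcup => i.
have [[y [Ay yi]]|nF] := pselect (exists y, F i y); last first.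
  rewrite (_ : F i = set0); first exact: sigma_algebra0.
  by apply/seteqP; split=> // y Fy; apply: nF; exists y.
apply: sub_sigma_algebra; exists y => //; apply/seteqP; split=> z.
  move=> yz; split; first exact: sat yz Ay.
  by rewrite -yi; congr pickle; apply/prefix_ofP/cyl_sym.
by move=> [_]; rewrite -yi => /(pcan_inj pickleK)/esym/prefix_ofP.
Qed.

(** The sets saturated for the cylinders of level [n] form a sigma-algebra. *)
Lemma filtration_leveled n (A : set (vilenkin_point m)) :
  filtration n A -> forall x y, cyl n x y -> A x -> A y.
Proof.
pose S : set (set (vilenkin_point m)) :=
  [set A | forall x y, cyl n x y -> A x -> A y].
suff sub : filtration n `<=` S by move=> /sub.
apply: smallest_sub; last first.
  by move=> _ [x _ <-] y z yz xy; apply: cyl_trans xy yz.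
split=> [//|B SB x y xy [_ nBx]|F SF x y xy [i _ Fx]].
  by split=> // By; apply: nBx; apply: SB By; apply: cyl_sym.
by exists i => //; apply: SF Fx.
Qed.

Lemma filtration_sub n (A : set (vilenkin_point m)) :
  filtration n A -> measurable (A : set (vilenkin m)).
Proof.
by apply: sub_sigma_algebra2 => _ [x _ <-]; exists n, x.
Qed.

Lemma measurable_cyl n x : measurable (cyl n x : set (vilenkin m)).
Proof. by apply: sub_sigma_algebra; exists n, x. Qed.

Lemma leveled_preimage (T : Type) n (g : vilenkin_point m -> T) (B : set T) :
  leveled n g -> filtration n (g @^-1` B).
Proof.
move=> gn; apply: leveled_filtration => x y /gn.
by rewrite /preimage /= => ->.
Qed.

Lemma leveled_measurable (R : realType) n (g : vilenkin_point m -> R) :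
  leveled n g -> measurable_fun setT (g : vilenkin m -> R).
Proof.
move=> gn _ B mB; rewrite setTI; apply: (@filtration_sub n).
exact: leveled_preimage.
Qed.

Lemma leveled_bounded (R : realType) n (g : vilenkin_point m -> R) :
  leveled n g -> exists K : R, forall x, `|g x| <= K.
Proof.
move=> gn.
have hex (v : {dffun forall k : 'I_n, 'Z_(m k)}) :
    exists r : R, forall x, prefix_of n x = v -> g x = r.
  have [[y yv]|nv] := pselect (exists y, prefix_of n y = v).
    by exists (g y) => x xv; apply/gn/prefix_ofP; rewrite xv yv.
  by exists 0 => x xv; case: nv; exists x.
have [h hE] := boolp.choice hex.
exists (\sum_v `|h v|) => x; rewrite (hE _ x erefl).
by rewrite (bigD1 (prefix_of n x)) //= lerDl sumr_ge0.
Qed.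

End CylinderSets.

(** * The Haar integral and the orthogonality relations *)

Section HaarIntegral.
Context (R : realType) (m : nat -> nat) (m_ge2 : forall k, (2 <= m k)%N).
Context (mu : probability (vilenkin m) R) (mu_haar : is_haar mu).
Local Notation M := (genM m).
Implicit Types (x y : vilenkin_point m) (g h : vilenkin_point m -> R[i]).

Lemma haar_cyl n x : mu (cyl n x) = ((M n)%:R^-1)%:E.
Proof.
have := mu_haar n (fun k => [set x k]%SET).
rewrite (_ : [set _ | _] = cyl n x); last first.
  apply/seteqP; split=> y h k kn; first by have := h k kn; rewrite inE => /eqP.
  by rewrite inE; apply/eqP; apply: h.
move=> ->; congr (_%:E); elim: n => [|n IH].
  by rewrite big_ord0 invr1.
by rewrite big_ord_recr /= IH cards1 natrM invfM mul1r mulrC.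
Qed.

Lemma leveled_integrable n (g : vilenkin_point m -> R) (D : set (vilenkin m)) :
  measurable D -> leveled n g -> mu.-integrable D (EFin \o g).
Proof.
move=> mD gn; apply: (@measurable_bounded_integrable _ (vilenkin m)) => //.
- by rewrite (le_lt_trans (probability_le1 _ _)) ?ltry.
- by apply: measurable_funTS; apply: leveled_measurable gn.
- have [K gK] := leveled_bounded gn.
  exists K; split; first exact: num_real.
  by move=> y Ky x _ /=; apply: le_trans (gK x) (ltW Ky).
Qed.

Lemma leveled_Cintegrable n g : leveled n g -> Cintegrable mu g.
Proof.
move=> gn; split; apply: (leveled_integrable (n := n)) => //.
  exact: (leveled_comp (@complex.Re R)).
exact: (leveled_comp (@complex.Im R)).
Qed.

Lemma ReD (u v : R[i]) : complex.Re (u + v) = complex.Re u + complex.Re v.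
Proof. by case: u; case: v. Qed.

Lemma ImD (u v : R[i]) : complex.Im (u + v) = complex.Im u + complex.Im v.
Proof. by case: u; case: v. Qed.

Lemma CintegralD n (D : set (vilenkin m)) g h : measurable D ->
  leveled n g -> leveled n h ->
  Cintegral mu D (fun x => g x + h x) = Cintegral mu D g + Cintegral mu D h.
Proof.
move=> mD gn hn; rewrite /Cintegral; simpc.
have rg := leveled_comp (@complex.Re R) gn.
have ig := leveled_comp (@complex.Im R) gn.
have rh := leveled_comp (@complex.Re R) hn.
have ih := leveled_comp (@complex.Im R) hn.
rewrite -(RintegralD mD (leveled_integrable mD rg) (leveled_integrable mD rh)).
rewrite -(RintegralD mD (leveled_integrable mD ig) (leveled_integrable mD ih)).
by congr (_ +i* _); apply: eq_Rintegral => x _; rewrite (ReD, ImD).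
Qed.

Lemma CintegralZ n (D : set (vilenkin m)) (c : R[i]) g : measurable D ->
  leveled n g -> Cintegral mu D (fun x => c * g x) = c * Cintegral mu D g.
Proof.
move=> mD gn; rewrite /Cintegral; case: c => a b; simpc.
have rg := leveled_comp (@complex.Re R) gn.
have ig := leveled_comp (@complex.Im R) gn.
have irg := leveled_integrable mD rg.
have iig := leveled_integrable mD ig.
rewrite -!RintegralZl // -RintegralB; [|exact: mD| |]; last first.
- exact: (leveled_integrable mD (leveled_comp ( *%R b) ig)).
- exact: (leveled_integrable mD (leveled_comp ( *%R a) rg)).
rewrite -RintegralD; [|exact: mD| |]; last first.
- exact: (leveled_integrable mD (leveled_comp ( *%R b) rg)).
- exact: (leveled_integrable mD (leveled_comp ( *%R a) ig)).
by congr (_ +i* _); apply: eq_Rintegral => x _; case: (g x).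
Qed.

Lemma Cintegral0 (D : set (vilenkin m)) : Cintegral mu D (fun=> 0) = 0.
Proof.
by rewrite /Cintegral /Rintegral /=; congr (_ +i* _); rewrite integral0.
Qed.

Lemma leveled_sum n N (G : nat -> vilenkin_point m -> R[i]) :
  (forall j, (j < N)%N -> leveled n (G j)) ->
  leveled n (fun x => \sum_(j < N) G j x).
Proof. by move=> Gn x y xy; apply: eq_bigr => j _; apply: Gn. Qed.

Lemma Cintegral_sum n N (D : set (vilenkin m)) (G : nat -> _) : measurable D ->
  (forall j, (j < N)%N -> leveled n (G j)) ->
  Cintegral mu D (fun x => \sum_(j < N) G j x) =
  \sum_(j < N) Cintegral mu D (G j).
Proof.
move=> mD; elim: N => [|N IH] Gn.
  by rewrite big_ord0 -[RHS](Cintegral0 D); congr Cintegral;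
    apply/funext => x; rewrite big_ord0.
rewrite big_ord_recr /= -IH; last by move=> j jN; apply: Gn; apply: ltnW.
rewrite -(CintegralD (n := n)) //.
- by congr Cintegral; apply/funext => x; rewrite big_ord_recr.
- by apply: leveled_sum => j jN; apply: Gn; apply: ltnW.
- exact: Gn.
Qed.

Lemma Cintegral_cyl (D : set (vilenkin m)) n x : measurable D ->
  Cintegral mu D (fun y => (\1_(cyl n x) y)%:C) =
  (fine (mu (cyl n x `&` D)))%:C.
Proof.
move=> mD; rewrite /Cintegral /Rintegral /= integral_indic //; last first.
  exact: measurable_cyl.
by rewrite integral0.
Qed.

(** Adding one to the coordinate [l] modulo [m l].  This translation preserves
    the Haar measure and multiplies every character by a root of unity, which
    is how the orthogonality relations are obtained below. *)
Definition rot (l : nat) x : vilenkin_point m := fun k => x k + (k == l)%:R.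

Lemma rot_cyl l n y :
  rot l @^-1` cyl n y = cyl n (fun k => y k - (k == l)%:R).
Proof.
apply/seteqP; split=> x xy k kn; first by rewrite -(xy k kn) /rot addrK.
by rewrite /rot xy // subrK.
Qed.

Lemma cyl_rot l n x y : cyl n x y -> cyl n (rot l x) (rot l y).
Proof. by move=> xy k kn; rewrite /rot xy. Qed.

Lemma rot_leveled l (T : Type) n (g : vilenkin_point m -> T) :
  leveled n g -> leveled n (g \o rot l).
Proof. by move=> gn x y xy; apply: gn; apply: cyl_rot. Qed.

Lemma measurable_rot l :
  measurable_fun setT (rot l : vilenkin m -> vilenkin m).
Proof.
apply: (@measurability _ _ (vilenkin m) (vilenkin m) setT (rot l)
  (@cylinders m)) => //.
move=> _ [_ [n [x ->]] <-]; rewrite setTI rot_cyl.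
exact: measurable_cyl.
Qed.

(** The cylinders and the empty set form a pi-system generating the
    measurable sets, and a rotation permutes the cylinders of a given level,
    which all have the same measure. *)
Lemma haar_rot l (A : set (vilenkin m)) : measurable A ->
  pushforward mu (rot l : vilenkin m -> vilenkin m) A = mu A.
Proof.
pose G : set (set (vilenkin m)) := fun A => A = set0 \/ cylinders A.
have mG : measurable = <<s G >> :> set (set (vilenkin m)).
  apply/seteqP; split=> B.
    by apply: sub_sigma_algebra2 => C CG; right.
  apply: smallest_sub; first exact: sigma_algebra_measurable.
  by move=> C [->|[n [x ->]]]; [exact: measurable0|exact: measurable_cyl].
apply: (@measure_unique _ _ _ G (fun=> setT) mG _ _ _
  (pushforward mu (rot l : vilenkin m -> vilenkin m)) mu).
- move=> A1 A2 [->|[n1 [x1 ->]]]; first by left; rewrite set0I.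
  move=> [->|[n2 [x2 ->]]]; first by left; rewrite setI0.
  have [[y [y1 y2]]|nex] :=
      pselect (exists y, cyl n1 x1 y /\ cyl n2 x2 y); last first.
    by left; apply/seteqP; split=> // y h; apply: nex; exists y.
  right; exists (maxn n1 n2), y; apply/seteqP; split=> z.
    move=> [z1 z2] k; rewrite leq_max => /orP[kn|kn].
      by rewrite z1 // y1.
    by rewrite z2 // y2.
  move=> yz; split.
    by apply: cyl_trans y1 (cyl_weak _ yz); rewrite leq_maxl.
  by apply: cyl_trans y2 (cyl_weak _ yz); rewrite leq_maxr.
- by move=> _; right; exists 0%N, (origin m); apply/seteqP; split.
- by apply/seteqP; split=> // x _; exists 0%N.
- exact: measurable_rot.
- move=> mrot B [->|[n [x ->]]].
    by rewrite !measure0.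
  transitivity (mu (cyl n (fun k => x k - (k == l)%:R))).
    by rewrite -rot_cyl.
  exact: etrans (haar_cyl _ _) (esym (haar_cyl _ _)).
- move=> mrot _; rewrite [X in (X < _)%E](_ : _ = mu setT) //.
  by rewrite probability_setT ltry.
Qed.

Lemma Rintegral_rot l n (g : vilenkin_point m -> R) : leveled n g ->
  \int[mu]_x g (rot l x) = \int[mu]_x g x.
Proof.
move=> gn; rewrite /Rintegral; congr fine.
have mg := (@measurable_EFinP _ (vilenkin m) R setT g).2
  (leveled_measurable gn).
have ig := leveled_integrable (D := setT) measurableT (rot_leveled l gn).
have := integral_pushforward (measurable_rot l) (mu := mu) (D := setT) mg ig
  measurableT.
rewrite preimage_setT => <-.
apply: eq_measure_integral => [|mrot A mA _]; first exact: measurable_rot.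
exact: haar_rot.
Qed.

Lemma Cintegral_rot l n g : leveled n g ->
  Cintegral mu setT (g \o rot l) = Cintegral mu setT g.
Proof.
move=> gn; rewrite /Cintegral.
have rg := leveled_comp (@complex.Re R) gn.
have ig := leveled_comp (@complex.Im R) gn.
by rewrite -(Rintegral_rot l rg) -(Rintegral_rot l ig).
Qed.

Lemma rademacher_rot k l x :
  rademacher R k (rot l x) =
  cis (pi *+ 2 / (m k)%:R) ^+ (k == l) * rademacher R k x.
Proof.
have mk0 : (m k)%:R != 0 :> R by rewrite pnatr_eq0 -lt0n (leq_trans _ (m_ge2 k)).
rewrite !rademacherE /rot; case: eqVneq => [_|_]; last first.
  by rewrite addr0 expr0 mul1r.
rewrite expr1 -cisD -mulrS.
have zk := Zp_cast (m_ge2 k).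
have -> : nat_of_ord (x k + 1) = ((x k).+1 %% (Zp_trunc (m k)).+2)%N.
  by rewrite /= modnDmr addn1.
have := ltn_ord (x k); rewrite leq_eqVlt => /predU1P[e|xlt]; last first.
  by rewrite modn_small.
by rewrite e modnn mulr0n cis0 zk -[X in cis X]mulr_natr divfK // cis2pi.
Qed.

Lemma psi_rot n l x : (l < n)%N ->
  psi R n (rot l x) =
  cis (pi *+ 2 / (m l)%:R) ^+ digit m n l * psi R n x.
Proof.
move=> ln; rewrite /psi.
suff H N : \prod_(k < N) rademacher R k (rot l x) ^+ digit m n k =
    (if (l < N)%N then cis (pi *+ 2 / (m l)%:R) ^+ digit m n l else 1) *
    \prod_(k < N) rademacher R k x ^+ digit m n k by rewrite H ln.
elim: N => [|N IH]; first by rewrite !big_ord0 mulr1.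
rewrite !big_ord_recr /= IH rademacher_rot exprMn ltnS.
case: ltngtP => [lN|lN|->].
- by rewrite expr0 expr1n mul1r mulrA.
- by rewrite expr0 expr1n !mul1r.
- by rewrite expr1 mul1r mulrCA.
Qed.

Lemma leveled_psi i : leveled i (psi R i : vilenkin_point m -> R[i]).
Proof. by move=> x y; apply: psi_level. Qed.

(** Orthogonality of the characters to the indicators of the cylinders around
    the origin: if [M_a <= i], the leading digit [l] of [i] is at least [a], so
    rotating the coordinate [l] preserves the cylinder while it multiplies
    [psi_i] by a root of unity other than 1. *)
Lemma Cintegral_cyl_psi a i :
  Cintegral mu setT (fun x => (\1_(cyl a (origin m)) x)%:C * (psi R i x)^*%R) =
  if (i < M a)%N then ((M a)%:R^-1)%:C else 0.
Proof.
case: ltnP => [ia|ai].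
  transitivity (Cintegral mu setT (fun y => (\1_(cyl a (origin m)) y)%:C)).
    congr Cintegral; apply/funext => x; rewrite indicE.
    case: (boolP (x \in _)) => [|_]; rewrite ?mul0r // inE => xa.
    by rewrite (psi_cyl0 R m_ge2 ia xa) (rmorph1 Num.conj) mulr1.
  rewrite Cintegral_cyl // setIT.
  by congr (_%:C); have -> := haar_cyl a (origin m).
have i0 : (0 < i)%N := leq_trans (genM_gt0 m_ge2 a) ai.
have [l /andP[li il]] := genM_bracket m_ge2 i0.
have al : (a <= l)%N.
  rewrite leqNgt; apply/negP => /(genM_le m_ge2); lia.
have lei : (l < i)%N := leq_trans (ltn_genM m_ge2 l) li.
have d := @digit_top _ m_ge2 i l; rewrite li il in d.
have /andP[d0 dm] := d isT.
set g := fun x => _.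
have gn : leveled (maxn a i) g.
  apply: leveled_comp2.
    apply: (leveled_comp (real_complex R)); apply: (leveledW (n := a)).
      exact: leq_maxl.
    exact: leveled_indic.
  apply: (leveled_comp Num.conj); apply: (leveledW (n := i)).
    exact: leq_maxr.
  exact: leveled_psi.
pose w : R[i] := (cis (pi *+ 2 / (m l)%:R) ^+ digit m i l)^*%R.
have gw : g \o rot l = fun x => w * g x.
  apply/funext => x; rewrite /g /w /= psi_rot // rmorphM /= !indicE.
  have -> : (rot l x \in cyl a (origin m)) = (x \in cyl a (origin m)).
    apply/idP/idP; rewrite !inE => h k ka.
      by rewrite -(h k ka) /rot (ltn_eqF (leq_trans ka al)) addr0.
    by rewrite /rot (ltn_eqF (leq_trans ka al)) addr0 h.
  by rewrite mulrCA.
have w1 : w != 1.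
  have m0 : 0 < (m l)%:R :> R by rewrite ltr0n (leq_trans _ (m_ge2 l)).
  have p0 : 0 < pi *+ 2 :> R by have := pi_gt0 R; lra.
  rewrite /w -cisMn -[X in cis X]mulr_natr; apply/negP => /eqP /(congr1 Num.conj).
  rewrite conjCK rmorph1 => /eqP; apply/negP; apply: cis_neq1.
    by rewrite !mulr_gt0 ?invr_gt0 // ltr0n.
  rewrite mulrAC -mulrA gtr_pMr //.
  by rewrite ltr_pdivrMr // mul1r ltr_nat.
have := Cintegral_rot l gn; rewrite gw (CintegralZ _ _ gn) //.
move=> /eqP; rewrite -subr_eq0 -[X in _ - X]mul1r -mulrBl mulf_eq0.
by rewrite subr_eq0 (negPf w1) => /eqP.
Qed.

End HaarIntegral.

(** * Lacunary martingales and their Fourier coefficients *)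

Section LacunaryMartingale.
Context (R : realType) (m : nat -> nat) (m_ge2 : forall k, (2 <= m k)%N).
Context (mu : probability (vilenkin m) R) (mu_haar : is_haar mu).
Context (a : nat -> nat) (a_lt : forall k, (a k < a k.+1)%N).
Local Notation M := (genM m).
Local Notation I0 b := (cyl b (origin m)).
Implicit Types (x y : vilenkin_point m) (c : nat -> R).

Lemma level_lt j k : (j < k)%N -> (a j < a k)%N.
Proof. by move=> jk; apply: (homo_ltn ltn_trans _ jk) => i; apply: a_lt. Qed.

Lemma level_ge j : (j <= a j)%N.
Proof. by elim: j => // j IH; apply: leq_ltn_trans IH _. Qed.

(** The terms whose level is below [N].  The bound [j < N] loses nothing since
    [j <= a j]; it makes the sum finite. *)
Definition gated (V : nmodType) (N : nat) (t : nat -> V) : V :=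
  \sum_(j < N) (if (a j < N)%N then t j else 0).

(** This serves twice: for the martingale property, where the terms [t j] are
    integrals of blocks over a set of level [n], and for the Fourier
    coefficients, where it shows that the limit is reached. *)
Lemma gated_stable (V : nmodType) n N (t : nat -> V) : (n <= N)%N ->
  (forall j, (n <= a j)%N -> t j = 0) -> gated N t = gated n t.
Proof.
move=> nN t0; have [d ->] : exists d, N = (n + d)%N.
  by exists (N - n)%N; rewrite subnKC.
rewrite /gated big_split_ord /=.
rewrite [X in _ + X]big1 ?addr0 => [|j _]; last first.
  by rewrite t0 ?if_same // (leq_trans _ (level_ge _)) ?leq_addr.
apply: eq_bigr => j _; case: (ltnP (a j) n) => [an|na].
  by rewrite ltn_addr.
by rewrite t0 ?if_same.
Qed.

Lemma gated_single (V : nmodType) N (t : nat -> V) k : (a k < N)%N ->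
  (forall j, j != k -> t j = 0) -> gated N t = t k.
Proof.
move=> aN t0; have kN : (k < N)%N := leq_ltn_trans (level_ge k) aN.
rewrite /gated (bigD1 (Ordinal kN)) //= aN big1 ?addr0 // => j.
by rewrite -val_eqE /= => jk; rewrite t0 ?if_same.
Qed.

(** The difference of the Dirichlet kernels of orders [M_(b+1)] and [M_b]. *)
Definition block (b : nat) x : R :=
  (M b.+1)%:R * \1_(I0 b.+1) x - (M b)%:R * \1_(I0 b) x.

Lemma blockE b x : (block b x)%:C =
  (M b.+1)%:R%:C * (\1_(I0 b.+1) x)%:C + (- (M b)%:R%:C) * (\1_(I0 b) x)%:C.
Proof. by rewrite /block rmorphB !rmorphM /= mulNr. Qed.

Lemma leveled_Cindic b b' : (b <= b')%N ->
  leveled b' (fun x => (\1_(I0 b) x : R)%:C).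
Proof.
move=> bb; apply: (leveled_comp (real_complex R)); apply: (leveledW bb).
exact: leveled_indic.
Qed.

Lemma leveled_block b n : (b < n)%N -> leveled n (fun x => (block b x)%:C).
Proof.
move=> bn x y xy; rewrite !blockE.
by rewrite (leveled_Cindic bn xy) (leveled_Cindic (ltnW bn) xy).
Qed.

Lemma block_bound b x : `|block b x| <= (M b.+1)%:R * \1_(I0 b) x.
Proof.
have Mb : (M b)%:R <= (M b.+1)%:R :> R by rewrite ler_nat genM_le.
have M0 : 0 <= (M b)%:R :> R by [].
have M1 : 0 <= (M b.+1)%:R :> R by [].
rewrite /block !indicE.
have [xb|xb] := boolP (x \in I0 b); last first.
  rewrite (_ : (x \in I0 b.+1) = false) ?mulr0 ?subr0 ?normr0 //.
  apply/negP => h; move/negP: xb; apply; move: h; rewrite !inE.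
  by apply: cyl_weak.
case: (x \in I0 b.+1); rewrite ?mulr0 ?mulr1 ler_norml; lra.
Qed.

(** A set of level [n <= b] contains the cylinder of level [b] around the
    origin or is disjoint from it; in the first case the two kernels both have
    integral 1. *)
Lemma Cintegral_block b n A : (n <= b)%N -> filtration n A ->
  Cintegral mu A (fun x => (block b x)%:C) = 0.
Proof.
move=> nb fA; have mA := filtration_sub fA.
under eq_fun do rewrite blockE.
have l1 := @leveled_Cindic b.+1 b.+1 (leqnn _).
have l0 := @leveled_Cindic b b.+1 (leqnSn _).
rewrite (CintegralD mu mA (leveled_comp ( *%R _) l1) (leveled_comp ( *%R _) l0)).
rewrite (CintegralZ mu _ mA l1) (CintegralZ mu _ mA l0) !Cintegral_cyl //.
have M1 : (M b.+1)%:R != 0 :> R by rewrite pnatr_eq0 -lt0n genM_gt0.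
have M0 : (M b)%:R != 0 :> R by rewrite pnatr_eq0 -lt0n genM_gt0.
have [oA|noA] := pselect (A (origin m)).
  have sub b' : (b <= b')%N -> I0 b' `&` A = I0 b'.
    move=> bb; apply/setIidl => x xb.
    apply: filtration_leveled fA _ _ _ oA; apply: cyl_weak xb.
    exact: leq_trans bb.
  rewrite !sub //.
  have -> : mu (I0 b.+1) = _ := haar_cyl mu_haar b.+1 (origin m).
  have -> : mu (I0 b) = _ := haar_cyl mu_haar b (origin m).
  by rewrite mulNr -!rmorphM /= !divff // subrr.
have sub b' : (b <= b')%N -> I0 b' `&` A = set0.
  move=> bb; apply/seteqP; split=> // x [xb xA]; apply: noA.
  apply: filtration_leveled fA _ _ _ xA; apply: cyl_sym; apply: cyl_weak xb.
  exact: leq_trans bb.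
by rewrite !sub // measure0 !mulr0 addr0.
Qed.

Lemma Cintegral_block_psi b i :
  Cintegral mu setT (fun x => (block b x)%:C * (psi R i x)^*%R) =
  if (M b <= i < M b.+1)%N then 1 else 0.
Proof.
have mT := @measurableT _ (vilenkin m).
pose h b' x : R[i] := (\1_(I0 b') x)%:C * (psi R i x)^*%R.
have lh b' : (b' <= b.+1)%N -> leveled (maxn b.+1 i) (h b').
  move=> bb; apply: leveled_comp2.
    by apply: leveled_Cindic; apply: leq_trans bb (leq_maxl _ _).
  apply: (leveled_comp Num.conj); apply: (leveledW (n := i)).
    exact: leq_maxr.
  exact: leveled_psi.
have l1 := lh _ (leqnn b.+1); have l0 := lh _ (leqnSn b).
transitivity (Cintegral mu setT
    (fun x => (M b.+1)%:R%:C * h b.+1 x + (- (M b)%:R%:C) * h b x)).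
  by congr Cintegral; apply/funext => x; rewrite blockE mulrDl -!mulrA.
rewrite (CintegralD mu mT (leveled_comp ( *%R _) l1) (leveled_comp ( *%R _) l0)).
rewrite (CintegralZ mu _ mT l1) (CintegralZ mu _ mT l0).
rewrite !(Cintegral_cyl_psi m_ge2 mu_haar).
have M1 : (M b.+1)%:R != 0 :> R by rewrite pnatr_eq0 -lt0n genM_gt0.
have M0 : (M b)%:R != 0 :> R by rewrite pnatr_eq0 -lt0n genM_gt0.
case: (ltnP i (M b)) => [ib|bi] /=.
  have -> : (i < M b.+1)%N := leq_trans ib (genM_le m_ge2 (leqnSn b)).
  by rewrite mulNr -!rmorphM /= !divff // subrr.
case: ltnP => _; rewrite !mulr0 addr0 //.
by rewrite -rmorphM /= divff.
Qed.

Definition lacunary c (n : nat) x : R[i] :=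
  gated n (fun j => (c j)%:C * (block (a j) x)%:C).

Lemma lacunary_term c n j : leveled n (fun x =>
  if (a j < n)%N then (c j)%:C * (block (a j) x)%:C else 0).
Proof.
case: ltnP => // an.
by apply: (leveled_comp ( *%R (c j)%:C)); apply: leveled_block.
Qed.

Lemma leveled_lacunary c n : leveled n (lacunary c n).
Proof. exact: (leveled_sum (N := n) (fun j _ => @lacunary_term c n j)). Qed.

Lemma Cintegral_lacunary c n A : measurable (A : set (vilenkin m)) ->
  Cintegral mu A (lacunary c n) =
  gated n (fun j => (c j)%:C * Cintegral mu A (fun x => (block (a j) x)%:C)).
Proof.
move=> mA; transitivity (\sum_(j < n) Cintegral mu A (fun x =>
    if (a j < n)%N then (c j)%:C * (block (a j) x)%:C else 0)).
  exact: (Cintegral_sum mu mA (N := n) (fun j _ => @lacunary_term c n j)).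
apply: eq_bigr => j _; case: ltnP => [an|_]; last exact: Cintegral0.
by rewrite (CintegralZ mu _ mA (leveled_block an)).
Qed.

Lemma martingale_lacunary c : martingale mu (lacunary c).
Proof.
split.
- move=> n B _; split; apply: leveled_preimage; apply: leveled_comp;
    exact: leveled_lacunary.
- by move=> n; apply: leveled_Cintegrable (@leveled_lacunary c n).
- move=> n k A nk fA; have mA := filtration_sub fA.
  rewrite !Cintegral_lacunary //; apply: gated_stable => // j nj.
  by rewrite (Cintegral_block nj fA) mulr0.
Qed.

Lemma fourier_lacunary c i :
  fourier_coef mu (lacunary c) i =
  gated i.+1 (fun j =>
    if (M (a j) <= i < M (a j).+1)%N then (c j)%:C else 0).
Proof.
pose t j : R[i] := if (M (a j) <= i < M (a j).+1)%N then (c j)%:C else 0.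
rewrite -/t /fourier_coef.
apply: (@lim_near_cst R[i]^o); first exact: norm_hausdorff.
exists i.+1 => //= N iN.
have -> : Cintegral mu setT (fun x => lacunary c N x * (psi R i x)^*%R)
    = gated N t.
  transitivity (Cintegral mu setT (fun x => \sum_(j < N)
      (if (a j < N)%N then (c j)%:C else 0) *
      ((if (a j < N)%N then block (a j) x else 0)%:C * (psi R i x)^*%R))).
    congr Cintegral; apply/funext => x; rewrite /lacunary /gated big_distrl.
    by apply: eq_bigr => j _; case: ifP => _; rewrite /= ?mul0r // mulrA.
  pose H j x : R[i] :=
    (if (a j < N)%N then block (a j) x else 0)%:C * (psi R i x)^*%R.
  have lH j : leveled (maxn N i) (H j).
    apply: leveled_comp2.
      case: ltnP => // an; apply: leveled_block.
      by apply: leq_trans an (leq_maxl _ _).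
    apply: (leveled_comp Num.conj); apply: (leveledW (n := i)).
      exact: leq_maxr.
    exact: leveled_psi.
  have mT := @measurableT _ (vilenkin m).
  rewrite (@Cintegral_sum _ _ _ (maxn N i) _ _ (fun j x =>
    (if (a j < N)%N then (c j)%:C else 0) * H j x) mT); last first.
    by move=> j _; apply: leveled_comp.
  apply: eq_bigr => j _; rewrite (CintegralZ mu _ mT (lH j)).
  case: ifP => [an|_]; last by rewrite mul0r.
  rewrite /H an Cintegral_block_psi /t.
  by case: ifP => _; rewrite ?mulr1 ?mulr0.
apply: gated_stable => // j ij; rewrite /t ifF //; apply/negP => /andP[+ _].
by rewrite leqNgt (leq_trans _ (ltn_genM m_ge2 (a j))) // ltnW.
Qed.

Lemma fourier_lacunary_on c k i : (M (a k) <= i < M (a k).+1)%N ->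
  fourier_coef mu (lacunary c) i = (c k)%:C.
Proof.
move=> /andP[ki ik]; rewrite fourier_lacunary (@gated_single _ _ _ k).
- by rewrite ki ik.
- by rewrite ltnS (leq_trans (ltnW (ltn_genM m_ge2 _)) ki).
- move=> j; rewrite neq_ltn => /orP[/level_lt jk|/level_lt kj].
    by rewrite [(i < _)%N]ltnNge (leq_trans (genM_le m_ge2 jk) ki) andbF.
  by rewrite leqNgt (leq_trans ik (genM_le m_ge2 kj)).
Qed.

Lemma fourier_lacunary_off c i :
  (forall k, ~~ (M (a k) <= i < M (a k).+1)%N) ->
  fourier_coef mu (lacunary c) i = 0.
Proof.
move=> off; rewrite fourier_lacunary; apply: big1 => j _.
by rewrite (negPf (off j)) if_same.
Qed.

End LacunaryMartingale.

(** * Membership in the Hardy space *)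

Section MonotoneIntegral.
Local Open Scope ereal_scope.

(** The integral of a nonnegative function is the supremum of the integrals of
    the simple functions below it, so it is monotone even where measurability
    is unknown; this spares a discussion of the maximal functions. *)
Lemma ge0_le_integralT d (T : measurableType d) (R : realType)
    (mu : {measure set T -> \bar R}) (f g : T -> \bar R) :
  (forall x, 0 <= f x) -> (forall x, f x <= g x) ->
  \int[mu]_x f x <= \int[mu]_x g x.
Proof.
move=> f0 fg; rewrite !ge0_integralTE //; last first.
  by move=> x; apply: le_trans (f0 x) (fg x).
apply: le_ereal_sup => _ [h hf <-]; exists h => // x.
exact: le_trans (hf x) (fg x).
Qed.

End MonotoneIntegral.

Section PowerSubadditivity.
Context (R : realType) (p : R) (p_gt0 : 0 < p) (p_le1 : p <= 1).

(** After dividing by [x + y], this is [t <= t ^ p] for [t] in [0, 1]. *)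
Lemma powR_subadditive (x y : R) : 0 <= x -> 0 <= y ->
  (x + y) `^ p <= x `^ p + y `^ p.
Proof.
move=> x0 y0; have [s0|s0] := eqVneq (x + y) 0.
  by rewrite s0 powR0 ?gt_eqF // addr_ge0 // powR_ge0.
have sp : 0 < x + y by rewrite lt_def s0 addr_ge0.
have part z : 0 <= z -> z <= x + y -> (x + y) `^ p * (z / (x + y)) <= z `^ p.
  rewrite le_eqVlt => /predU1P[<-|z0] zs; first by rewrite mul0r mulr0 powR_ge0.
  have -> : z `^ p = (x + y) `^ p * (z / (x + y)) `^ p.
    by rewrite -powRM ?(ltW sp) ?divr_ge0 ?(ltW z0) ?(ltW sp) // mulrC divfK.
  apply: ler_wpM2l; first exact: powR_ge0.
  by apply: ger1_powR p_le1; rewrite divr_gt0 //= ler_pdivrMr // mul1r.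
have -> : (x + y) `^ p =
    (x + y) `^ p * (x / (x + y)) + (x + y) `^ p * (y / (x + y)).
  by rewrite -mulrDr -mulrDl divff // mulr1.
by apply: lerD; apply: part; rewrite ?lerDl ?lerDr.
Qed.

Lemma powR_sum_le n (F : nat -> R) : (forall j, 0 <= F j) ->
  (\sum_(j < n) F j) `^ p <= \sum_(j < n) F j `^ p.
Proof.
move=> F0; elim: n => [|n IH]; first by rewrite !big_ord0 powR0 ?gt_eqF.
rewrite !big_ord_recr /=; apply: le_trans (powR_subadditive _ _) _ => //.
  exact: sumr_ge0.
by rewrite lerD2r.
Qed.

End PowerSubadditivity.

Section HardyNorm.
Context (R : realType) (m : nat -> nat) (m_ge2 : forall k, (2 <= m k)%N).
Context (mu : probability (vilenkin m) R) (mu_haar : is_haar mu).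
Context (a : nat -> nat) (a_lt : forall k, (a k < a k.+1)%N).
Context (B : nat) (m_le : forall k, (m k <= B)%N).
Context (p : R) (p_gt0 : 0 < p) (p_le1 : p <= 1).
Context (c : nat -> R) (c_ge0 : forall k, 0 <= c k).
Local Notation M := (genM m).
Local Notation I0 b := (cyl b (origin m)).
Implicit Types x : vilenkin_point m.

Lemma normc_real (r : R) : Normc.normc r%:C = `|r|.
Proof. by rewrite /Normc.normc /= expr0n addr0 sqrtr_sqr. Qed.

Lemma lacunary_pow_bound n x :
  Normc.normc (lacunary a c n x) `^ p <=
  \sum_(j < n) (c j * (M (a j).+1)%:R) `^ p * \1_(I0 (a j)) x.
Proof.
pose F j : R := c j * (M (a j).+1)%:R * \1_(I0 (a j)) x.
have F0 j : 0 <= F j by rewrite /F indicE !mulr_ge0.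
have -> : lacunary a c n x =
    (\sum_(j < n) (if (a j < n)%N then c j * block R (a j) x else 0))%:C.
  rewrite rmorph_sum; apply: eq_bigr => j _.
  by case: ifP; rewrite // rmorphM.
rewrite normc_real; apply: le_trans (_ : (\sum_(j < n) F j) `^ p <= _).
  apply: ge0_ler_powR; rewrite ?nnegrE ?(ltW p_gt0) ?sumr_ge0 //.
  apply: le_trans (ler_norm_sum _ _ _) _; apply: ler_sum => j _.
  case: ifP => _; last by rewrite normr0 F0.
  by rewrite normrM ger0_norm // /F -mulrA ler_wpM2l // block_bound.
apply: le_trans (powR_sum_le p_gt0 p_le1 _ F0) _; apply: ler_sum => j _.
rewrite /F indicE; case: (x \in _) => /=; rewrite ?mulr1 ?mulr0 //.
by rewrite powR0 ?gt_eqF.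
Qed.

(** The [p]-th power of the maximal function is at most the sum of the [p]-th
    powers of the bounds for the blocks; the [j]-th one is supported by a
    cylinder of measure [1 / M_(a_j)] and contributes at
    most [B ^ p / 2 ^ j.+1]. *)
Lemma lacunary_in_hardy :
  (forall k, (c k * (M (a k))%:R) `^ p <= (M (a k))%:R / (2 ^ k.+1)%:R) ->
  in_hardy mu p (lacunary a c).
Proof.
move=> c_small; split; first exact: martingale_lacunary.
pose w j : R := (c j * (M (a j).+1)%:R) `^ p.
have w0 j : 0 <= w j by apply: powR_ge0.
pose g j x : \bar R := (w j * \1_(I0 (a j)) x)%:E.
have g0 j x : (0 <= g j x)%E by rewrite lee_fin mulr_ge0 // indicE.
pose G x : \bar R := (\sum_(0 <= j <oo) g j x)%E.
have max_le x : (maximal (lacunary a c) x <= G x `^ p^-1)%E.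
  apply: ge_ereal_sup => _ [n _ <-].
  set r := Normc.normc _.
  have r0 : 0 <= r by rewrite /r; case: lacunary => u v; apply: sqrtr_ge0.
  have -> : r%:E = ((r `^ p)%:E `^ p^-1)%E.
    by rewrite poweR_EFin -powRrM mulfV ?gt_eqF // powRr1.
  apply: gt0_ler_poweR; rewrite ?invr_ge0 ?(ltW p_gt0) //.
  - by rewrite in_itv /= lee_fin powR_ge0 leey.
  - by rewrite in_itv /= leey nneseries_ge0.
  apply: le_trans (nneseries_lim_ge n _) => //.
  by rewrite sumEFin lee_fin big_mkord; apply: lacunary_pow_bound.
have max_ge0 x : (0 <= maximal (lacunary a c) x)%E.
  apply: le_trans (ereal_sup_ubound _); last by exists 0%N.
  by rewrite lee_fin; case: lacunary => u v; apply: sqrtr_ge0.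
rewrite /hardy_norm Lnorm.unlock; apply: poweR_lty.
have mT := @measurableT _ (vilenkin m).
apply: (@le_lt_trans _ _ (\int[mu]_x G x)%E).
  apply: ge0_le_integralT => x; first exact: poweR_ge0.
  rewrite gee0_abs // -[leRHS]poweRe1 ?nneseries_ge0 //.
  rewrite -(mulVf (lt0r_neq0 p_gt0)) poweRrM.
  apply: gt0_ler_poweR; rewrite ?(ltW p_gt0) // in_itv /= ?leey ?andbT //.
  exact: poweR_ge0.
rewrite integral_nneseries //; last first.
  move=> j; apply/measurable_EFinP; apply: (@leveled_measurable _ _ (a j)).
  by apply: (leveled_comp ( *%R (w j))); apply: leveled_indic.
apply: (@le_lt_trans _ _
  (\sum_(0 <= j <oo) ((B%:R `^ p) / (2 ^ j.+1)%:R)%:E)%E); last first.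
  apply: le_lt_trans (ltry (B%:R `^ p)).
  exact: (epsilon_trick0 xpredT (powR_ge0 _ _)).
apply: lee_nneseries => [j _ _|j _]; first exact: integral_ge0.
rewrite /g (integralZl_indic mT (fun=> I0 (a j))); last 2 first.
- by move=> wn; move: (w0 j); rewrite leNgt wn.
- exact: measurable_cyl.
rewrite integral_indic //; last exact: measurable_cyl.
rewrite setIT [X in (_ * X)%E](_ : _ = ((M (a j))%:R^-1)%:E); last first.
  exact: haar_cyl.
rewrite -EFinM lee_fin.
have Mj : 0 < (M (a j))%:R :> R by rewrite ltr0n genM_gt0.
rewrite ler_pdivrMr // -mulrA [_^-1 * _]mulrC.
apply: le_trans (_ : _ <= B%:R `^ p * (c j * (M (a j))%:R) `^ p) _.
  rewrite -powRM ?mulr_ge0 //; apply: ge0_ler_powR;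
    rewrite ?nnegrE ?mulr_ge0 ?(ltW p_gt0) //.
  by rewrite mulrCA ler_wpM2l // -natrM ler_nat /= leq_mul.
by rewrite ler_wpM2l ?powR_ge0.
Qed.

End HardyNorm.

(** * The lower bound for the T means *)

Section LowerBound.
Context (R : realType) (m : nat -> nat) (m_ge2 : forall k, (2 <= m k)%N).
Context (mu : probability (vilenkin m) R) (mu_haar : is_haar mu).
Context (q : nat -> R) (q_ge0 : forall k, 0 <= q k) (q0_gt0 : 0 < q 0%N).
Local Notation M := (genM m).
Implicit Types x : vilenkin_point m.

Lemma normc_ge0 (z : R[i]) : 0 <= Normc.normc z.
Proof. by case: z => u v; apply: sqrtr_ge0. Qed.

Lemma normc_sum n (F : nat -> R[i]) :
  Normc.normc (\sum_(j < n) F j) <= \sum_(j < n) Normc.normc (F j).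
Proof.
elim: n => [|n IH]; first by rewrite !big_ord0 Normc.normc0.
rewrite !big_ord_recr /=; apply: le_trans (le_normcD _ _) _.
by rewrite lerD2r.
Qed.

Lemma Qsum_gt0 n : (0 < n)%N -> 0 < Qsum q n.
Proof.
case: n => // n _; rewrite /Qsum big_ord_recl.
by apply: ltr_wpDr => //; apply: sumr_ge0.
Qed.

(** If the terms of the Fourier series at [x] of indices [N], ..., [N + L - 2]
    all equal [w], then [S_(N+u) f x = S_N f x + u * w] for [u < L], and the
    terms of index below [N] contribute at most the sum of the absolute values
    of their coefficients to any weighted mean of the partial sums. *)
Lemma T_mean_lower (f : nat -> vilenkin_point m -> R[i]) (N L : nat) x
    (w : R[i]) (C : R) : (0 < N + L)%N ->
  (forall i, (i.+1 < L)%N -> fourier_coef mu f (N + i) * psi R (N + i) x = w) ->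
  \sum_(i < N) Normc.normc (fourier_coef mu f i) <= C ->
  Normc.normc w * (\sum_(u < L) q (N + u)%N * u%:R) / Qsum q (N + L) - C <=
  Normc.normc (T_mean mu q f (N + L) x).
Proof.
move=> NL wE CE; set s := \sum_(u < L) _.
have Q0 := Qsum_gt0 NL.
pose S j := partial_sum mu f j x.
have S_le j : (j <= N)%N -> Normc.normc (S j) <= C.
  move=> jN; apply: le_trans CE; rewrite /S /partial_sum.
  apply: le_trans (normc_sum _ (fun k => fourier_coef mu f k * psi R k x)) _.
  have [d ->] : exists d, N = (j + d)%N by exists (N - j)%N; rewrite subnKC.
  rewrite big_split_ord /= ler_wpDr //.
    by apply: sumr_ge0 => i _; apply: normc_ge0.
  by apply: ler_sum => i _; rewrite Normc.normcM normc_psi // mulr1.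
have S_add u : (u < L)%N -> S (N + u)%N = S N + w *+ u.
  elim: u => [|u IH] uL; first by rewrite addn0 addr0.
  rewrite addnS /S /partial_sum big_ord_recr /= -/(partial_sum mu f (N + u) x).
  by rewrite wE // -/(S _) IH ?(ltnW uL) // mulrSr addrA.
pose E := \sum_(j < N + L) (q j)%:C * S (minn j N).
have ET : \sum_(j < N + L) (q j)%:C * partial_sum mu f j x = E + s%:C * w.
  rewrite /E !big_split_ord /= -addrA; congr (_ + _).
    by apply: eq_bigr => j _; rewrite (minn_idPl (ltnW (ltn_ord j))).
  rewrite /s rmorph_sum /= big_distrl -big_split /=; apply: eq_bigr => u _.
  rewrite (minn_idPr (leq_addr _ _)) -/(S _) S_add // mulrDr; congr (_ + _).
  rewrite rmorphM /= -mulrA; congr (_ * _).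
  by rewrite -[LHS]mulr_natl (rmorph_nat (real_complex R)).
have E_le : Normc.normc E <= Qsum q (N + L) * C.
  rewrite /E; apply: le_trans (normc_sum _ (fun j => (q j)%:C * S (minn j N))) _.
  rewrite /Qsum big_distrl; apply: ler_sum => j _.
  rewrite Normc.normcM normc_real ger0_norm // ler_wpM2l //.
  by apply: S_le; apply: geq_minr.
have s0 : 0 <= s by apply: sumr_ge0 => u _; rewrite mulr_ge0.
rewrite /T_mean ET Normc.normcM normc_real ger0_norm ?invr_ge0 ?(ltW Q0) //.
rewrite [leRHS]mulrC ler_pdivlMr // mulrBl divfK ?gt_eqF //.
have : Normc.normc (s%:C * w) <=
    Normc.normc (E + s%:C * w) + Normc.normc (- E).
  apply: le_trans (le_normcD _ _); by rewrite addrAC subrr add0r.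
rewrite normcN Normc.normcM normc_real ger0_norm // [_ * s]mulrC [C * _]mulrC.
move: E_le; lra.
Qed.

Lemma sum_prefix n P (K : R) : 0 <= K ->
  \sum_(i < n) (if (i < P)%N then K else 0) <= K * P%:R.
Proof.
move=> K0; have -> : \sum_(i < n) (if (i < P)%N then K else 0) = K *+ minn n P.
  elim: n => [|n IH]; first by rewrite big_ord0 min0n.
  rewrite big_ord_recr /= IH; case: (ltnP n P) => h.
    by rewrite (minn_idPl h) mulrSr.
  by rewrite (minn_idPr (leqW h)) addr0.
by rewrite -[leLHS]mulr_natr ler_wpM2l // ler_nat geq_minr.
Qed.

Context (a : nat -> nat) (a_lt : forall k, (a k < a k.+1)%N).
Context (c : nat -> R) (c_ge0 : forall k, 0 <= c k).

Lemma fourier_lacunary_low k b (K : R) : 0 <= K ->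
  (forall j, (j < k)%N -> (a j <= b)%N /\ c j <= K) ->
  \sum_(i < M (a k)) Normc.normc (fourier_coef mu (lacunary a c) i) <=
  K * (M b.+1)%:R.
Proof.
move=> K0 low; apply: le_trans (sum_prefix (M (a k)) _ K0).
apply: ler_sum => i _.
have [[j ji]|off] := pselect (exists j, (M (a j) <= i < M (a j).+1)%N).
  rewrite (fourier_lacunary_on m_ge2 mu_haar a_lt _ ji).
  have /andP[ji1 ji2] := ji.
  have jk : (j < k)%N.
    rewrite ltnNge; apply/negP; rewrite leq_eqVlt => /predU1P[kj|kj].
      by move: ji1; rewrite -kj leqNgt ltn_ord.
    have := leq_trans (genM_le m_ge2 (ltnW (level_lt a_lt kj))) ji1.
    by rewrite leqNgt ltn_ord.
  have [ab cK] := low j jk.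
  by rewrite (leq_trans ji2) ?genM_le // normc_real ger0_norm.
rewrite (fourier_lacunary_off m_ge2 mu_haar a_lt); last first.
  by move=> j; apply/negP => h; apply: off; exists j.
by rewrite Normc.normc0; case: ifP.
Qed.

(** The lower bound behind both parts of the theorem: up to the contribution
    of the earlier blocks, the [T] mean of order [M_(a k) + L] has the size it
    would have for the single block [k]. *)
Lemma T_mean_lacunary k b (K : R) L x : 0 <= K ->
  (forall j, (j < k)%N -> (a j <= b)%N /\ c j <= K) ->
  (M (a k) + L <= M (a k).+1)%N ->
  (forall i, (i.+1 < L)%N -> psi R (M (a k) + i) x = psi R (M (a k)) x) ->
  c k * (\sum_(u < L) q (M (a k) + u)%N * u%:R) / Qsum q (M (a k) + L)
    - K * (M b.+1)%:R <=
  Normc.normc (T_mean mu q (lacunary a c) (M (a k) + L) x).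
Proof.
move=> K0 low ML psiE.
have := @T_mean_lower (lacunary a c) (M (a k)) L x
  ((c k)%:C * psi R (M (a k)) x) (K * (M b.+1)%:R).
rewrite Normc.normcM normc_real normc_psi mulr1 ger0_norm //; apply.
- by rewrite addn_gt0 genM_gt0.
- move=> i iL; rewrite psiE //.
  rewrite (@fourier_lacunary_on _ _ m_ge2 _ mu_haar _ a_lt _ k) //.
  by rewrite leq_addr (leq_trans _ ML) // ltn_add2l ltnW.
- exact: fourier_lacunary_low.
Qed.

End LowerBound.

(** * Choice of the levels *)

Section ChoiceOfLevels.
Context (R : realType) (m : nat -> nat) (m_ge2 : forall k, (2 <= m k)%N).
Context (B : nat) (m_le : forall k, (m k <= B)%N).
Local Notation M := (genM m).

Lemma limn_esup_pinfty (u : nat -> R) :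
  limn_esup (fun n => (u n)%:E) = +oo%E ->
  forall (K : R) (N : nat), exists2 n, (N <= n)%N & K < u n.
Proof.
move=> uoo K N; apply: contrapT => nex.
suff : (limn_esup (fun n => (u n)%:E) <= K%:E)%E by rewrite uoo leye_eq.
apply: (@le_trans _ _ (ereal_sup ((fun n => (u n)%:E) @` [set n | (N <= n)%N]))).
  apply: ereal_inf_lbound; exists [set n | (N <= n)%N] => //.
  by exists N.
apply: ge_ereal_sup => _ [n /= Nn <-]; rewrite lee_fin leNgt.
by apply/negP => h; apply: nex; exists n.
Qed.

Definition previous (nn : nat -> nat) (k : nat) : nat :=
  if k is k'.+1 then nn k' else 0%N.

(** The required height of a level depends only on the preceding one, so the
    levels are chosen recursively; [0] stands for the level before the
    first. *)
Lemma choose_levels (Good : nat -> nat -> nat -> Prop) :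
  (forall k b, exists2 n, (b < n)%N & Good k b n) ->
  exists nn : nat -> nat, [/\ forall k, (0 < nn k)%N,
    forall k, (nn k < nn k.+1)%N & forall k, Good k (previous nn k) (nn k)].
Proof.
move=> ex.
have ex' (kb : nat * nat) : exists n, (kb.2 < n)%N /\ Good kb.1 kb.2 n.
  by have [n ? ?] := ex kb.1 kb.2; exists n.
have [pick pickP] := boolp.choice ex'.
pose nn := fix nn k := if k is k'.+1 then pick (k, nn k') else pick (0, 0)%N.
exists nn; split=> [[|k]|k|[|k]].
- exact: (pickP (0, 0)%N).1.
- exact: leq_ltn_trans (pickP (k.+1, nn k)).1.
- exact: (pickP (k.+1, nn k)).1.
- exact: (pickP (0, 0)%N).2.
- exact: (pickP (k.+1, nn k)).2.
Qed.

(** Every large index lies between two consecutive even levels; going two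
    levels down leaves room for the orders of the means that are used. *)
Lemma level_below b : exists N0, forall N, (N0 <= N)%N ->
  exists2 n, (b < n)%N &
    [/\ (4 * M (2 * n) <= N)%N, (N <= B ^ 4 * M (2 * n))%N
      & (N < M (2 * n + 4))%N].
Proof.
exists (M (2 * b + 4)) => N N0.
have Npos : (0 < N)%N := leq_trans (genM_gt0 m_ge2 _) N0.
have [l /andP[lN Nl]] := genM_bracket m_ge2 Npos.
have bl : (2 * b + 4 <= l)%N.
  rewrite leqNgt; apply/negP => /(genM_le m_ge2) h.
  by have := leq_trans Nl (leq_trans h N0); rewrite ltnn.
pose n := (l./2 - 1)%N.
have ln : (2 * n + 2 <= l < 2 * n + 4)%N.
  by have := odd_double_half l; rewrite /n -muln2; case: (odd l); lia.
have /andP[ln1 ln2] := ln.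
have N4 : (N < M (2 * n + 4))%N := leq_trans Nl (genM_le m_ge2 ln2).
exists n; first lia; split=> //.
  apply: leq_trans (leq_trans (genM_le m_ge2 ln1) lN).
  have := genM_double m_ge2 (ltnSn (2 * n)).
  have := genM_double m_ge2 (ltnSn (2 * n).+1).
  rewrite addn2; lia.
exact: leq_trans (ltnW N4) (genM_bound _ _ m_le).
Qed.

(** The coefficients for which the [k]-th block contributes [2 ^- k.+1], up to a
    constant factor, to the [p]-th power of the Hardy norm. *)
Definition coef (p : R) (k n : nat) : R :=
  ((M (2 * n))%:R `^ (1 - p) / (2 ^ k.+1)%:R) `^ p^-1.

(** A bound for all the coefficients up to level [b], independent of their
    rank. *)
Definition coef_bound (p : R) (b : nat) : R :=
  ((M (2 * b))%:R `^ (1 - p)) `^ p^-1.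

Section Coefficients.
Context (p : R) (p_gt0 : 0 < p) (p_le1 : p <= 1).

Lemma coef_ge0 k n : 0 <= coef p k n.
Proof. exact: powR_ge0. Qed.

Lemma coef_bound_ge0 b : 0 <= coef_bound p b.
Proof. exact: powR_ge0. Qed.

Lemma coef_le j n b : (n <= b)%N -> coef p j n <= coef_bound p b.
Proof.
move=> nb; apply: ge0_ler_powR; rewrite ?nnegrE ?invr_ge0 ?(ltW p_gt0) //.
apply: (@le_trans _ _ ((M (2 * n))%:R `^ (1 - p))).
  rewrite ler_pdivrMr ?ltr0n ?expn_gt0 // ler_peMr ?powR_ge0 //.
  by rewrite ler1n expn_gt0.
apply: ge0_ler_powR; rewrite ?nnegrE ?subr_ge0 //.
by rewrite ler_nat genM_le // leq_mul2l nb orbT.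
Qed.

Lemma coef_pow k n :
  (coef p k n * (M (2 * n))%:R) `^ p <= (M (2 * n))%:R / (2 ^ k.+1)%:R.
Proof.
have M0 : 0 < (M (2 * n))%:R :> R by rewrite ltr0n genM_gt0.
rewrite powRM ?coef_ge0 // /coef -powRrM mulVf ?gt_eqF //.
rewrite powRr1 ?divr_ge0 ?powR_ge0 //.
by rewrite mulrAC -powRD ?subrK ?powRr1 // gt_eqF // implybT.
Qed.

End Coefficients.
End ChoiceOfLevels.

Section LacunaryChoice.
Context (R : realType) (m : nat -> nat) (m_ge2 : forall k, (2 <= m k)%N).
Context (B : nat) (m_le : forall k, (m k <= B)%N).
Context (mu : probability (vilenkin m) R) (mu_haar : is_haar mu).
Context (q : nat -> R) (q_ge0 : forall k, 0 <= q k) (q0_gt0 : 0 < q 0%N).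
Context (phi : nat -> R) (phi_weight : increasing_weight phi).
Context (p : R) (p_gt0 : 0 < p) (p_le1 : p <= 1).
Context (nn : nat -> nat) (nn_gt0 : forall k, (0 < nn k)%N).
Context (nn_lt : forall k, (nn k < nn k.+1)%N).
Local Notation M := (genM m).

Definition hump : nat -> vilenkin_point m -> R[i] :=
  lacunary (fun k => 2 * nn k)%N (fun k => coef m p k (nn k)).

Let a_lt k : (2 * nn k < 2 * nn k.+1)%N.
Proof. by rewrite ltn_mul2l nn_lt. Qed.

Lemma hump_in_hardy : in_hardy mu p hump.
Proof.
apply: (lacunary_in_hardy m_ge2 mu_haar a_lt m_le p_gt0 p_le1).
  by move=> k; apply: powR_ge0.
by move=> k; apply: (coef_pow m_ge2 p_gt0).
Qed.

(** Dividing by the weight: the contribution of the earlier blocks stays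
    bounded because the weight is at least one. *)
Lemma weighted_maximal_ge k L (r : R) N x : (M (2 * nn k) + L <= N)%N ->
  (L <= M (2 * nn k))%N ->
  (forall i, (i.+1 < L)%N ->
     psi R (M (2 * nn k) + i) x = psi R (M (2 * nn k)) x) ->
  r <= (\sum_(u < L) q (M (2 * nn k) + u)%N * u%:R) /
         Qsum q (M (2 * nn k) + L) -> 0 <= r ->
  ((coef m p k (nn k) * r / phi N -
     coef_bound m p (previous nn k) * (M (2 * previous nn k).+1)%:R)%:E <=
   weighted_maximal_T mu q phi hump x)%E.
Proof.
move=> MLN LM psiE rle r0.
have MLpos : (0 < M (2 * nn k) + L)%N by rewrite addn_gt0 genM_gt0.
apply: le_trans (ereal_sup_ubound _); last by exists (M (2 * nn k) + L)%N.
rewrite lee_fin.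
have [phi1 phi_le] := phi_weight.
have low j : (j < k)%N ->
    (2 * nn j <= 2 * previous nn k)%N /\
    coef m p j (nn j) <= coef_bound m p (previous nn k).
  case: k {MLN LM psiE rle MLpos} => // k; rewrite ltnS /= => jk.
  have njk : (nn j <= nn k)%N.
    by move: jk; rewrite leq_eqVlt => /predU1P[->//|/(level_lt nn_lt)/ltnW].
  by split; [rewrite leq_mul2l | apply: coef_le].
have ML : (M (2 * nn k) + L <= M (2 * nn k).+1)%N.
  by apply: leq_trans (genM_double m_ge2 (ltnSn _)); lia.
have := T_mean_lacunary m_ge2 mu_haar q_ge0 q0_gt0 a_lt
  (fun k => coef_ge0 m p k (nn k)) (coef_bound_ge0 m p (previous nn k)) low
  ML psiE.
set T := Normc.normc _; set C := coef_bound _ _ _ * _; rewrite -mulrA.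
set c := coef _ _ _ _; set s := _ / Qsum _ _ => TE.
have C0 : 0 <= C by rewrite mulr_ge0 ?coef_bound_ge0.
have c0 : 0 <= c by apply: coef_ge0.
have phiML : 1 <= phi (M (2 * nn k) + L)%N by apply: phi1.
have phiMLN : phi (M (2 * nn k) + L)%N <= phi N by apply: phi_le.
set P := phi (M (2 * nn k) + L)%N in phiML phiMLN *.
have P0 : 0 < P by lra.
have PN : 0 < phi N by lra.
apply: (@le_trans _ _ ((c * r - C) / P)); last first.
  rewrite ler_pM2r ?invr_gt0 //; apply: le_trans TE.
  by rewrite lerB // ler_wpM2l.
rewrite mulrBl; apply: lerB.
  by rewrite ler_wpM2l ?mulr_ge0 // lef_pV2.
by rewrite ler_pdivrMr // ler_peMr.
Qed.

End LacunaryChoice.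

(** * Divergence for p < 1/2 *)

Section WeakPart.
Context (R : realType) (m : nat -> nat) (m_ge2 : forall k, (2 <= m k)%N).
Context (B : nat) (m_le : forall k, (m k <= B)%N).
Context (mu : probability (vilenkin m) R) (mu_haar : is_haar mu).
Context (q : nat -> R) (q_ge0 : forall k, 0 <= q k) (q0_gt0 : 0 < q 0%N).
Context (phi : nat -> R) (phi_weight : increasing_weight phi).
Local Notation M := (genM m).

Lemma weak_Lnorm_pinfty (p : R) (g : vilenkin_point m -> \bar R) : 0 < p ->
  (forall x, g x = +oo%E) -> weak_Lnorm mu p g = +oo%E.
Proof.
move=> p0 goo; rewrite /weak_Lnorm (_ : ereal_sup _ = +oo%E).
  by rewrite poweRyr // invr_neq0 // gt_eqF.
apply/eqyP => A A0; apply: ereal_sup_ubound.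
exists (A `^ p^-1); first exact: powR_gt0.
rewrite (_ : [set x | _] = setT); last first.
  by apply/seteqP; split=> // x _; rewrite /= goo ltry.
by rewrite probability_setT mule1 -powRrM mulVf ?gt_eqF // powRr1 ?ltW.
Qed.

(** Up to a factor depending on [k] only, [coef k n / M_(2n)] is
    [M_(2n)^(1/p - 2)], and [M_(2n)] is comparable with the order [N] at which
    the growth condition provides a large quotient. *)
Lemma exists_weak_level (p kappa : R) : 0 < p -> p < 2^-1 -> 0 < kappa ->
  limn_esup (fun n : nat =>
    ((n.+1%:R : R) `^ (p^-1 - 2) / phi n.+1)%:E) = +oo%E ->
  forall k b, exists2 n, (b < n)%N &
    exists2 N, (4 * M (2 * n) <= N)%N &
      k%:R + coef_bound m p b * (M (2 * b).+1)%:R <=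
      coef m p k n * (kappa / (M (2 * n))%:R) / phi N.
Proof.
move=> p0 p2 kappa0 lim k b; set X := _ + _.
have [phi1 _] := phi_weight.
pose e := p^-1 - 2; have e0 : 0 < e.
  by rewrite subr_gt0 -[ltLHS]invrK ltf_pV2 // posrE invr_gt0.
pose w : R := ((2 ^ k.+1)%:R^-1) `^ p^-1.
have w0 : 0 < w by rewrite powR_gt0 // invr_gt0 ltr0n expn_gt0.
pose Be : R := (B ^ 4)%:R `^ e.
have B0 : (0 < B)%N by apply: leq_trans (m_le 0); apply: ltnW.
have Be0 : 0 < Be by rewrite powR_gt0 // ltr0n expn_gt0 B0.
have [N0 lev] := level_below m_ge2 m_le b.
have [i Ni Di] := limn_esup_pinfty lim (X * Be / (kappa * w)) N0.
have [n bn [N4 NB _]] := lev i.+1 (leqW Ni).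
exists n => //; exists i.+1 => //.
have P0 : 0 < phi i.+1 by apply: lt_le_trans (phi1 _ _).
have M0 : 0 < (M (2 * n))%:R :> R by rewrite ltr0n genM_gt0.
have -> : coef m p k n * (kappa / (M (2 * n))%:R) =
    kappa * w * (M (2 * n))%:R `^ e.
  rewrite /coef powRM ?powR_ge0 // -/w -powRrM mulrBl mul1r mulfV ?gt_eqF //.
  have -> : p^-1 - 1 = e + 1 by rewrite /e; ring.
  rewrite powRD; last by apply/implyP => _; rewrite gt_eqF.
  by rewrite powRr1 ?ltW //; field; rewrite gt_eqF.
rewrite ler_pdivlMr //.
have Ne : i.+1%:R `^ e <= Be * (M (2 * n))%:R `^ e.
  rewrite /Be -powRM //; apply: ge0_ler_powR; rewrite ?nnegrE ?(ltW e0) //.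
  by rewrite -natrM ler_nat.
move: Di; rewrite ltr_pdivlMr // => /lt_le_trans/(_ Ne)/ltW.
rewrite mulrAC ler_pdivrMr ?mulr_gt0 // => h.
by rewrite -(ler_pM2l Be0); lra.
Qed.

(** Every order [M_(2 n_k) + 2] gives a lower bound that is independent of the
    point, so the weighted maximal function is infinite everywhere. *)
Lemma weak_divergence (p kappa : R) : 0 < p -> p < 2^-1 -> 0 < kappa ->
  (forall n, kappa / (M (2 * n))%:R <=
     q (M (2 * n) + 1)%N / Qsum q (M (2 * n) + 2)) ->
  limn_esup (fun n : nat =>
    ((n.+1%:R : R) `^ (p^-1 - 2) / phi n.+1)%:E) = +oo%E ->
  exists2 f : nat -> vilenkin_point m -> R[i],
    in_hardy mu p f &
    weak_Lnorm mu p (weighted_maximal_T mu q phi f) = +oo%E.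
Proof.
move=> p0 p2 kappa0 qQ lim.
have p1 : p <= 1 by apply: ltW (lt_trans p2 _); rewrite invf_lt1 // ltr1n.
have [nn [nn0 nn_lt nnE]] := choose_levels (exists_weak_level p0 p2 kappa0 lim).
exists (hump p nn); first exact: (hump_in_hardy m_ge2 m_le mu_haar).
apply: weak_Lnorm_pinfty => // x; apply/eqyP => A A0.
have [N MN kN] := nnE (Num.bound A).
set k := Num.bound A in N MN kN *.
have M0 : 0 < (M (2 * nn k))%:R :> R by rewrite ltr0n genM_gt0.
have M2 : (2 <= M (2 * nn k))%N.
  by apply: leq_ltn_trans (ltn_genM m_ge2 _); have := nn0 k; lia.
have := @weighted_maximal_ge _ _ m_ge2 _ mu_haar _ q_ge0 q0_gt0 _ phi_weight
  _ p0 p1 _ nn_lt k 2 (kappa / (M (2 * nn k))%:R) N x.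
move=> lower; apply: le_trans (lower _ _ _ _ _); first 1 last.
- by clear -M2 MN; move: (M _) M2 MN => z; lia.
- exact: M2.
- by case=> // _; rewrite addn0.
- by rewrite big_ord_recr big_ord1 /= mulr0 add0r mulr1; apply: qQ.
- by rewrite divr_ge0 // ltW.
rewrite lee_fin lerBrDr; apply: le_trans kN; rewrite lerD2r.
by apply: ltW; apply: archi_boundP; apply: ltW.
Qed.

End WeakPart.

(** * Divergence for p = 1/2 *)

Section StrongPart.
Context (R : realType) (m : nat -> nat) (m_ge2 : forall k, (2 <= m k)%N).
Context (B : nat) (m_le : forall k, (m k <= B)%N).
Context (mu : probability (vilenkin m) R) (mu_haar : is_haar mu).
Context (q : nat -> R) (q_ge0 : forall k, 0 <= q k) (q0_gt0 : 0 < q 0%N).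
Context (phi : nat -> R) (phi_weight : increasing_weight phi).
Local Notation M := (genM m).
Local Notation I0 b := (cyl b (origin m)).

Lemma B_gt0 : (0 < B)%N.
Proof. by apply: leq_trans (m_le 0); apply: ltnW. Qed.

(** The order [N] at which the growth condition provides a large quotient is
    below [M_(2n+4)], so its logarithm is at most a multiple of [n]. *)
Lemma exists_strong_level (kappa : R) : 0 < kappa ->
  limn_esup (fun n : nat => (ln (n.+1%:R : R) ^+ 2 / phi n.+1)%:E) = +oo%E ->
  forall k b, exists2 n, (b < n)%N &
    exists2 N, (4 * M (2 * n) <= N)%N &
      k%:R + Num.sqrt (coef_bound m 2^-1 b * (M (2 * b).+1)%:R) <=
      n%:R * Num.sqrt (kappa / (2 ^ k.+1)%:R ^+ 2 / phi N) / 2.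
Proof.
move=> kappa0 lim k b; set X := _ + Num.sqrt _.
have [phi1 _] := phi_weight.
have X0 : 0 <= X by rewrite addr_ge0 // sqrtr_ge0.
pose E : R := kappa / (2 ^ k.+1)%:R ^+ 2.
have E0 : 0 < E by rewrite divr_gt0 // exprn_gt0 // ltr0n expn_gt0.
have [N0 lev] := level_below m_ge2 m_le b.
pose lB : R := ln B%:R.
have lB0 : 0 <= lB by rewrite ln_ge0 // ler1n B_gt0.
have [i Ni Di] := limn_esup_pinfty lim ((2 * X) ^+ 2 * (6 * lB) ^+ 2 / E) N0.
have [n bn [N4 _ NM]] := lev i.+1 (leqW Ni).
exists n => //; exists i.+1 => //; rewrite -/E.
have P0 : 0 < phi i.+1 by apply: lt_le_trans (phi1 _ _).
have n0 : (0 < n)%N := leq_ltn_trans (leq0n b) bn.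
have n1 : 1 <= n%:R :> R by rewrite ler1n.
have lnN : ln (i.+1%:R : R) <= 6 * n%:R * lB.
  apply: (@le_trans _ _ (ln ((B ^ (2 * n + 4))%:R : R))).
    rewrite ler_ln ?posrE ?ltr0n ?expn_gt0 ?B_gt0 // ler_nat.
    apply: leq_trans (ltnW NM) _.
    by have := genM_bound 0 (2 * n + 4) m_le; rewrite add0n muln1.
  rewrite natrX lnXn ?ltr0n ?B_gt0 // -[leLHS]mulr_natl ler_wpM2r //.
  by rewrite natrD natrM; lra.
have lnN0 : 0 <= ln (i.+1%:R : R) by rewrite ln_ge0 // ler1n.
have sq : ln (i.+1%:R : R) ^+ 2 <= (6 * lB) ^+ 2 * n%:R ^+ 2.
  rewrite -exprMn lerXn2r ?nnegrE //; first by rewrite !mulr_ge0.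
  by move: lnN; rewrite mulrAC.
have key : (2 * X) ^+ 2 <= n%:R ^+ 2 * (E / phi i.+1).
  move: Di; rewrite ltr_pdivlMr // => /lt_le_trans/(_ sq).
  have [lB00|lBn0] := eqVneq lB 0.
    by rewrite lB00 mulr0 expr0n /= !mulr0 !mul0r ltxx.
  have l0 : 0 < (6 * lB) ^+ 2 by rewrite exprn_gt0 // mulr_gt0 // lt_def lBn0.
  rewrite mulrAC ltr_pdivrMr // mulrA ler_pdivlMr // => h.
  by rewrite -(ler_pM2l l0); lra.
rewrite ler_pdivlMr // mulrC.
rewrite -[leLHS]ger0_norm ?mulr_ge0 // -sqrtr_sqr.
rewrite -[X in X * Num.sqrt _]ger0_norm // -sqrtr_sqr -sqrtrM ?sqr_ge0 //.
by apply: ler_wsqrtr.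
Qed.

(** A function that is at least [A M_(2s)^2 - C] on the cylinder of level [2s]
    for every [s <= n] has a square root whose integral grows linearly in [n]:
    the difference of the cylinders of levels [2s] and [2s+1] has measure
    comparable with [1 / M_(2s)], so each scale contributes about
    [Num.sqrt A / 2]. *)
Lemma sqrt_integral_lower (F : vilenkin_point m -> \bar R) (n : nat) (A C : R) :
  0 <= A -> 0 <= C -> (forall x, (0 <= F x)%E) ->
  (forall s x, (0 < s <= n)%N -> I0 (2 * s) x ->
     ((A * (M (2 * s))%:R ^+ 2 - C)%:E <= F x)%E) ->
  ((n%:R * Num.sqrt A / 2 - Num.sqrt C)%:E <=
   \int[mu]_x (`|F x| `^ 2^-1))%E.
Proof.
move=> A0 C0 F0 FA.
have Mp b : 0 < (M b)%:R :> R by rewrite ltr0n genM_gt0.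
pose lev (i : nat) := (2 * i.+1)%N.
pose ring i : set (vilenkin m) := I0 (lev i) `\` I0 (lev i).+1.
pose v i : R := Num.max 0 (Num.sqrt A * (M (lev i))%:R - Num.sqrt C).
have v0 i : 0 <= v i by rewrite /v le_max lexx.
have mring i : measurable (ring i) by apply: measurableD; apply: measurable_cyl.
pose h x : \bar R := (\sum_(i < n) (v i * \1_(ring i) x)%:E)%E.
have ring_disj i j x : ring i x -> ring j x -> i = j.
  move=> [xi nxi] [xj nxj]; apply/eqP; rewrite eqn_leq.
  apply/andP; split; rewrite leqNgt; apply/negP => ij.
    by apply: nxj; apply: cyl_weak xi; rewrite /lev; lia.
  by apply: nxi; apply: cyl_weak xj; rewrite /lev; lia.
have sqrtF i x : (i < n)%N -> ring i x -> ((v i)%:E <= `|F x| `^ 2^-1)%E.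
  move=> iN [xi _]; have := FA i.+1 x; rewrite ltnS leq0n iN => /(_ isT xi).
  rewrite gee0_abs //; move: (F0 x); case: (F x) => [r| |] //; last first.
    by move=> _ _; rewrite poweRyr ?leey // invr_neq0.
  rewrite !lee_fin => r0 Ar; rewrite powR12_sqrt //.
  rewrite /v ge_max sqrtr_ge0 /=.
  have sA := sqr_sqrtr A0; have sC := sqr_sqrtr C0; have sr := sqr_sqrtr r0.
  have := sqrtr_ge0 A; have := sqrtr_ge0 C; have := sqrtr_ge0 r.
  move: Ar; rewrite -{1}sA -{1}sC -{1}sr.
  set a := Num.sqrt A; set cc := Num.sqrt C; set d := Num.sqrt r.
  rewrite -exprMn /lev; set z := a * _ => zd d0 c0 a0.
  rewrite leNgt; apply/negP => zlt; nra.
have hF x : (h x <= `|F x| `^ 2^-1)%E.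
  have [[i [iN xi]]|nex] := pselect (exists i, (i < n)%N /\ ring i x).
    rewrite /h (bigD1 (Ordinal iN)) //= big1 ?adde0 => [|j].
      by rewrite indicE mem_set // mulr1; apply: sqrtF.
    rewrite -val_eqE /= => ji; rewrite indicE memNset ?mulr0 // => xj.
    by move/eqP: ji; apply; apply: ring_disj xj xi.
  rewrite /h big1 ?poweR_ge0 // => j _; rewrite indicE memNset ?mulr0 // => xj.
  by apply: nex; exists j.
have h0 x : (0 <= h x)%E.
  by apply: sume_ge0 => i _; rewrite lee_fin mulr_ge0 // indicE.
apply: (@le_trans _ _ (\int[mu]_x h x)%E); last first.
  exact: (@ge0_le_integralT _ (vilenkin m) R mu).
have mT := @measurableT _ (vilenkin m).
rewrite /h (@ge0_integral_sum _ (vilenkin m) R mu setT mT _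
  (fun (i : 'I_n) x => (v i * \1_(ring i) x)%:E)); last 2 first.
- move=> i; apply/measurable_EFinP; apply: measurable_funM.
    exact: measurable_cst.
  by apply: measurable_indic.
- by move=> i x _; rewrite lee_fin mulr_ge0 // indicE.
have mu_ring i : mu (ring i) =
    ((M (lev i))%:R^-1 - (M (lev i).+1)%:R^-1)%:E.
  have mc b : measurable (I0 b : set (vilenkin m)) by apply: measurable_cyl.
  rewrite /ring measureD //; last first.
    by rewrite (le_lt_trans (probability_le1 _ _)) ?ltry.
  rewrite (_ : I0 (lev i) `&` _ = I0 (lev i).+1); last first.
    by apply/setIidr => x; apply: cyl_weak.
  by rewrite EFinB; congr (_ - _)%E; apply: haar_cyl.
rewrite (eq_bigr (fun i : 'I_n =>
    (v i * ((M (lev i))%:R^-1 - (M (lev i).+1)%:R^-1))%:E)); last first.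
  move=> i _; rewrite (integralZl_indic mT (fun=> ring i)) //; last first.
    by move=> wn; move: (v0 i); rewrite leNgt wn.
  by rewrite integral_indic // setIT [X in (_ * X)%E]mu_ring.
rewrite sumEFin lee_fin.
pose e i : R := (2 * (M (lev i))%:R)^-1.
have tail : \sum_(i < n) e i <= 1 - (M (2 * n))%:R^-1.
  elim: (n) => [|k IH]; first by rewrite big_ord0 muln0 invr1 subrr.
  rewrite big_ord_recr /=; apply: le_trans (lerD IH (lexx _)) _.
  have M4 : 4 * (M (2 * k))%:R <= (M (2 * k.+1))%:R :> R.
    rewrite -natrM ler_nat mulnS.
    have := genM_double m_ge2 (ltnSn (2 * k)).
    have := genM_double m_ge2 (ltnSn (2 * k).+1).
    rewrite add2n; lia.
  have : 4 * (M (2 * k.+1))%:R^-1 <= (M (2 * k))%:R^-1 :> R.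
    by rewrite ler_pdivrMr // mulrC ler_pdivlMr // mulrC.
  rewrite /e /lev invfM; have : 0 < (M (2 * k.+1))%:R^-1 :> R by rewrite invr_gt0.
  by set y := (M (2 * k.+1))%:R^-1; set z := (M (2 * k))%:R^-1; lra.
apply: (@le_trans _ _ (\sum_(i < n) (Num.sqrt A / 2 - Num.sqrt C * e i))).
  rewrite sumrB sumr_const card_ord -mulr_sumr.
  rewrite -[X in _ <= X - _]mulr_natl [X in _ <= X - _]mulrA lerB //.
  rewrite -[leRHS]mulr1 ler_wpM2l ?sqrtr_ge0 //; apply: le_trans tail _.
  by rewrite gerBl invr_ge0 ltW.
apply: ler_sum => i _.
have e0 : 0 < e i by rewrite invr_gt0 mulr_gt0.
apply: (@le_trans _ _ (v i * e i)); last first.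
  apply: ler_wpM2l => //; rewrite /e invfM.
  have : (M (lev i).+1)%:R^-1 <= 2^-1 * (M (lev i))%:R^-1 :> R.
    rewrite -invfM lef_pV2 ?posrE ?mulr_gt0 // -natrM ler_nat.
    exact: genM_double.
  by set y := (M (lev i))%:R^-1; set z := (M (lev i).+1)%:R^-1; lra.
apply: (@le_trans _ _ ((Num.sqrt A * (M (lev i))%:R - Num.sqrt C) * e i)).
  rewrite mulrBl lerB // le_eqVlt; apply/orP; left; apply/eqP.
  by rewrite /e; field; rewrite gt_eqF.
by apply: ler_wpM2r; [exact: ltW|rewrite /v le_max lexx orbT].
Qed.

Lemma sum_nat_pred L : \sum_(u < L) u%:R = L%:R * (L%:R - 1) / 2 :> R.
Proof.
elim: L => [|L IH]; first by rewrite big_ord0 !mul0r.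
by rewrite big_ord_recr /= IH -natr1; field.
Qed.

Lemma Qsum_le n n' : (n <= n')%N -> Qsum q n <= Qsum q n'.
Proof.
move=> nn; have [d ->] : exists d, n' = (n + d)%N.
  by exists (n' - n)%N; rewrite subnKC.
by rewrite /Qsum big_split_ord /= lerDl sumr_ge0.
Qed.

(** On the cylinder of level [2s] the means of order [M_(2n) + M_(2s)] of the
    block at level [2n] have size at least [M_(2s)^2 / M_(2n)], up to a
    constant: each of the weights is at least a fixed multiple of the average
    weight, and the inner Dirichlet kernels grow linearly. *)
Lemma weighted_kernel_lower (c : R) n s : 0 < c ->
  (forall n v, (v <= M (2 * n) + 1)%N ->
     c / (M (2 * n))%:R <= q v / Qsum q (M (2 * n) + 2)) ->
  (0 < s <= n)%N ->
  c / (B ^ 2)%:R / 4 * ((M (2 * s))%:R ^+ 2 / (M (2 * n))%:R) <=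
  (\sum_(u < M (2 * s)) q (M (2 * n) + u)%N * u%:R) /
    Qsum q (M (2 * n) + M (2 * s)).
Proof.
move=> c0 cq /andP[s0 sn].
have Mp b : 0 < (M b)%:R :> R by rewrite ltr0n genM_gt0.
have Msn : (M (2 * s) <= M (2 * n))%N by rewrite genM_le // leq_mul2l sn.
have M2 : (2 * M (2 * n) <= M (2 * n.+1))%N.
  by apply: genM_double => //; rewrite ltn_mul2l /=.
have MB : (M (2 * n.+1))%:R <= (B ^ 2)%:R * (M (2 * n))%:R :> R.
  by rewrite -natrM ler_nat mulnS addnC genM_bound.
have B2 : 0 < (B ^ 2)%:R :> R by rewrite ltr0n expn_gt0 B_gt0.
set L := M (2 * s) in Msn *.
have L2 : 2 <= L%:R :> R.
  rewrite ler_nat; apply: leq_trans (genM_double m_ge2 (_ : 0 < 2 * s)%N) => //.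
  by rewrite muln_gt0.
have Q2 : 0 < Qsum q (M (2 * n.+1) + 2) by apply: Qsum_gt0; rewrite // addn2.
have QL : 0 < Qsum q (M (2 * n) + L).
  by apply: Qsum_gt0; rewrite // addn_gt0 genM_gt0.
have QQ : Qsum q (M (2 * n) + L) <= Qsum q (M (2 * n.+1) + 2).
  apply: Qsum_le; apply: leq_trans (leq_addr _ _); apply: leq_trans M2.
  by rewrite [(2 * M (2 * n))%N]mul2n -addnn leq_add2l.
set Q := Qsum q (M (2 * n) + L) in QL QQ *.
pose t : R := c / (B ^ 2)%:R / (M (2 * n))%:R.
have t0 : 0 < t by rewrite !divr_gt0.
have qt u : (u < L)%N -> t * Q <= q (M (2 * n) + u)%N.
  move=> uL; have vle : (M (2 * n) + u <= M (2 * n.+1) + 1)%N.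
    apply: leq_trans (leq_addr _ _); apply: leq_trans M2.
    by rewrite [(2 * M (2 * n))%N]mul2n -addnn leq_add2l (leq_trans (ltnW uL)).
  have := cq n.+1 _ vle; rewrite ler_pdivlMr // => h; apply: le_trans h.
  apply: ler_pM => //; [exact: ltW|exact: ltW|].
  rewrite /t -mulrA -invfM ler_wpM2l ?(ltW c0) // lef_pV2 ?posrE //.
  exact: mulr_gt0.
rewrite ler_pdivlMr //.
apply: (@le_trans _ _ (t * Q * (L%:R * (L%:R - 1) / 2))); last first.
  rewrite -sum_nat_pred mulr_sumr; apply: ler_sum => u _.
  by rewrite ler_wpM2r // qt.
have -> : c / (B ^ 2)%:R / 4 * (L%:R ^+ 2 / (M (2 * n))%:R) * Q =
    t * Q * (L%:R ^+ 2 / 4).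
  by rewrite /t; field; rewrite gt_eqF // pnatr_eq0 -lt0n B_gt0.
apply: ler_wpM2l; first by rewrite mulr_ge0 // ltW.
nra.
Qed.

(** The bound of [sqrt_integral_lower] applies to every block [k], with [A]
    proportional to [1 / phi] and [C] the contribution of the earlier blocks. *)
Lemma strong_divergence (c : R) : 0 < c ->
  (forall n v, (v <= M (2 * n) + 1)%N ->
     c / (M (2 * n))%:R <= q v / Qsum q (M (2 * n) + 2)) ->
  limn_esup (fun n : nat => (ln (n.+1%:R : R) ^+ 2 / phi n.+1)%:E) = +oo%E ->
  exists2 f : nat -> vilenkin_point m -> R[i],
    in_hardy mu 2^-1 f &
    Lnorm mu (2^-1)%:E (weighted_maximal_T mu q phi f) = +oo%E.
Proof.
move=> c0 cq lim; have [phi1 phi_le] := phi_weight.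
have h0 : 0 < 2^-1 :> R by rewrite invr_gt0.
have h1 : 2^-1 <= 1 :> R by rewrite invf_le1 // ler1n.
pose kappa : R := c / (B ^ 2)%:R / 4.
have kappa0 : 0 < kappa by rewrite !divr_gt0 // ltr0n expn_gt0 B_gt0.
have [nn [nn0 nn_lt nnE]] := choose_levels (exists_strong_level kappa0 lim).
exists (hump 2^-1 nn); first exact: (hump_in_hardy m_ge2 m_le mu_haar).
set F := weighted_maximal_T _ _ _ _.
have F0 x : (0 <= F x)%E.
  apply: le_trans (ereal_sup_ubound _); last by exists 1%N.
  by rewrite lee_fin divr_ge0 ?normc_ge0 // (le_trans ler01) // phi1.
suff Ioo : (\int[mu]_x (`|F x| `^ 2^-1) = +oo)%E.
  by rewrite Lnorm.unlock Ioo poweRyr // invrK pnatr_eq0.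
apply/eqyP => A A0.
have [N MN kN] := nnE (Num.bound A).
set k := Num.bound A in MN kN *.
set C := coef_bound _ _ _ * _ in kN.
have C0 : 0 <= C by rewrite mulr_ge0 ?coef_bound_ge0.
set E := kappa / _ / _ in kN.
have M0 : 0 < (M (2 * nn k))%:R :> R by rewrite ltr0n genM_gt0.
have P0 : 0 < phi N.
  apply: lt_le_trans (phi1 N _) => //; apply: leq_trans MN.
  by rewrite muln_gt0 genM_gt0.
have k2 : 0 < (2 ^ k.+1)%:R :> R by rewrite ltr0n expn_gt0.
have E0 : 0 <= E by rewrite /E !divr_ge0 ?exprn_ge0 // ltW.
have coefE : coef m 2^-1 k (nn k) =
      (M (2 * nn k))%:R / (2 ^ k.+1)%:R ^+ 2 :> R.
  rewrite /coef (_ : 1 - 2^-1 = 2^-1 :> R); last by field.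
  rewrite invrK powR_mulrn ?divr_ge0 ?powR_ge0 ?(ltW k2) //.
  by rewrite expr_div_n powR12_sqrt ?(ltW M0) // sqr_sqrtr ?(ltW M0).
have FA s x : (0 < s <= nn k)%N -> I0 (2 * s) x ->
    ((E * (M (2 * s))%:R ^+ 2 - C)%:E <= F x)%E.
  move=> sn xs; have /andP[s0 sn'] := sn.
  have Msn : (M (2 * s) <= M (2 * nn k))%N by rewrite genM_le // leq_mul2l sn'.
  have := @weighted_maximal_ge _ _ m_ge2 _ mu_haar _ q_ge0 q0_gt0 _ phi_weight
    _ h0 h1 _ nn_lt k (M (2 * s))
    (kappa * ((M (2 * s))%:R ^+ 2 / (M (2 * nn k))%:R)) N x.
  move=> lower; apply: le_trans (lower _ _ _ _ _); first 1 last.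
  - by clear -Msn MN; move: (M (2 * s)) (M (2 * nn k)) Msn MN => y z; lia.
  - exact: Msn.
  - move=> i iM; apply: (psi_add _ m_ge2 _ _ xs); last exact: ltnW.
    by rewrite leq_mul2l sn'.
  - exact: weighted_kernel_lower.
  - by rewrite mulr_ge0 ?(ltW kappa0) // divr_ge0 ?exprn_ge0 ?ltW.
  rewrite lee_fin -/C lerB // le_eqVlt; apply/orP; left; apply/eqP.
  by rewrite coefE /E; field; rewrite !gt_eqF.
apply: le_trans (sqrt_integral_lower E0 C0 F0 FA).
rewrite lee_fin lerBrDr; apply: le_trans kN; rewrite lerD2r.
by apply: ltW; apply: archi_boundP; apply: ltW.
Qed.

End StrongPart.

(** * The theorem *)

Section WeightConditions.
Context (R : realType) (m : nat -> nat) (m_ge2 : forall k, (2 <= m k)%N).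
Context (q : nat -> R) (q_ge0 : forall k, 0 <= q k) (q0_gt0 : 0 < q 0%N).
Local Notation M := (genM m).

(** For nondecreasing weights the last weight of a sum is at least their
    average. *)
Lemma nondecreasing_last_weight n : nondecreasing_seq q ->
  3^-1 / (M (2 * n))%:R <= q (M (2 * n) + 1)%N / Qsum q (M (2 * n) + 2).
Proof.
move=> qnd; have M0 := genM_gt0 m_ge2 (2 * n); set N := M (2 * n) in M0 *.
have M1 : 1 <= N%:R :> R by rewrite ler1n.
have Q0 : 0 < Qsum q (N + 2) by apply: Qsum_gt0; rewrite // addn2.
rewrite ler_pdivlMr // -invfM mulrC ler_pdivrMr; last lra.
apply: (@le_trans _ _ (\sum_(i < N + 2) q (N + 1)%N)).
  apply: ler_sum => i _; apply: qnd.
  by rewrite -ltnS (leq_trans (ltn_ord i)) // addn2 addn1.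
rewrite sumr_const card_ord -[leLHS]mulr_natr ler_wpM2l //.
by rewrite natrD; lra.
Qed.

End WeightConditions.

Theorem theorem1 (R : realType) (m : nat -> nat)
    (m_ge2 : forall k, (2 <= m k)%N)
    (m_bounded : exists B : nat, forall k, (m k <= B)%N)
    (mu : probability (vilenkin m) R) (mu_haar : is_haar mu)
    (q : nat -> R) (q_ge0 : forall k, 0 <= q k) (q0_gt0 : 0 < q 0%N) :
  ((nondecreasing_seq q /\
      (exists2 c : R, 0 < c & forall n : nat,
         q 0%N / Qsum q (genM m (2 * n) + 2) >= c / (genM m (2 * n))%:R))
   \/
   (nonincreasing_seq q /\
      (exists2 c : R, 0 < c & forall n : nat,
         q (genM m (2 * n) + 1)%N / Qsum q (genM m (2 * n) + 2)
           >= c / (genM m (2 * n))%:R)) ->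
   forall phi : nat -> R, increasing_weight phi ->
     phi n @[n --> \oo] --> +oo ->
     limn_esup (fun n : nat => (ln (n.+1%:R : R) ^+ 2 / phi n.+1)%:E) = +oo%E ->
     exists2 f : nat -> vilenkin_point m -> R[i],
       in_hardy mu 2^-1 f &
       Lnorm mu (2^-1)%:E (weighted_maximal_T mu q phi f) = +oo%E)
  /\
  (forall p : R, 0 < p -> p < 2^-1 ->
   nondecreasing_seq q \/
   (nonincreasing_seq q /\
      (exists2 c : R, 0 < c & forall n : nat,
         q (genM m (2 * n) + 1)%N / Qsum q (genM m (2 * n) + 2)
           >= c / (genM m (2 * n))%:R)) ->
   forall phi : nat -> R, increasing_weight phi ->
     limn_esup (fun n : nat =>
       ((n.+1%:R : R) `^ (p^-1 - 2) / phi n.+1)%:E) = +oo%E ->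
     exists2 f : nat -> vilenkin_point m -> R[i],
       in_hardy mu p f &
       weak_Lnorm mu p (weighted_maximal_T mu q phi f) = +oo%E).
Proof.
have [B m_le] := m_bounded.
have Qpos N : 0 < Qsum q (N + 2) by apply: Qsum_gt0; rewrite // addn2.
split.
  move=> qcond phi phi_weight _ lim.
  suff [c c0 cq] : exists2 c : R, 0 < c &
      forall n v, (v <= genM m (2 * n) + 1)%N ->
        c / (genM m (2 * n))%:R <= q v / Qsum q (genM m (2 * n) + 2).
    exact: (strong_divergence m_ge2 m_le mu_haar q_ge0 q0_gt0 phi_weight c0 cq
      lim).
  case: qcond => -[qmon [c c0 cq]]; exists c => // n v vM;
    apply: le_trans (cq n) _; rewrite ler_pM2r ?invr_gt0 //.
  - exact: qmon.
  - exact: qmon.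
move=> p p0 p2 qcond phi phi_weight lim.
suff [c c0 cq] : exists2 c : R, 0 < c & forall n,
    c / (genM m (2 * n))%:R <=
    q (genM m (2 * n) + 1)%N / Qsum q (genM m (2 * n) + 2).
  exact: (weak_divergence m_ge2 m_le mu_haar q_ge0 q0_gt0 phi_weight p0 p2 c0 cq
    lim).
case: qcond => [qnd|[_ [c c0 cq]]]; last by exists c.
exists 3^-1; first by rewrite invr_gt0.
by move=> n; apply: nondecreasing_last_weight.
Qed.
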